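(* Let $m\ge1$. The Swiss Cheese operad $\mathcal{SC}_m$ has the structure of an $\mathcal{RK}_m$-cellular operad as well as the structure of an $\mathcal{RK}'_m$-cellular operad.
   Context: **SC type operads.** Coloured operads are symmetric, with components $\mathcal O(c_1,\dots,c_n;c)$ for $n\ge 0$, units, partial compositions $\circ_i$ (equivalently total compositions $\gamma^{\mathcal O}$) and symmetric group actions $\sigma:\mathcal O(c_1,\dots,c_n;c)\to\mathcal O(c_{\sigma^{-1}(1)},\dots,c_{\sigma^{-1}(n)};c)$. An SC type operad is a $\{\mathfrak{cl},\mathfrak{op}\}$-coloured operad (closed colour $\mathfrak{cl}$, open colour $\mathfrak{op}$) with $\mathcal O(c_1,\dots,c_n;\mathfrak{cl})=\emptyset$ whenever some $c_i=\mathfrak{op}$. **The Swiss Cheese operad $\mathcal{SC}_m$.** Let $Sym:\mathbb R^m\to\mathbb R^m$ be the reflection $Sym(x_1,\dots,x_m)=(x_1,\dots,x_{m-1},-x_m)$, let $Half_+=\{(x_1,\dots,x_m)\in\mathbb R^m: x_m>0\}$ and let $C_0=[-1,1]^m$ be the standard cube. A cube in the standard cube is a product $[x_1,y_1]\times\cdots\times[x_m,y_m]$ with $-1<x_j<y_j<1$ for all $j$. For $n\ge0$ and $c_i,c\in\{\mathfrak{cl},\mathfrak{op}\}$: $\mathcal{SC}_m(c_1,\dots,c_n;\mathfrak{cl})=\emptyset$ if some $c_i=\mathfrak{op}$; otherwise, for closed output, it is the $n$-th space of the little $m$-cubes operad (as defined by May). For open output, $\mathcal{SC}_m(c_1,\dots,c_n;\mathfrak{op})$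 is: the empty set if $n=0$; the one-point space if $n=1$; and, if $n=s+t\ge2$ where $s$ of the colours $c_i$ are $\mathfrak{cl}$ and $t$ of them are $\mathfrak{op}$, the space of configurations of $2s+t$ disjoint cubes $(C_1,\dots,C_{2s+t})$ in $C_0$ such that $Sym(C_i)=C_{i+s}$ for $1\le i\le s$, $Sym(C_i)=C_i$ for $2s+1\le i\le 2s+t$, and all the cubes $C_1,\dots,C_s$ are in the upper half space $Half_+$. (By symmetry such a configuration may be seen as one of $s$ cubes, labelled by the closed inputs, and $t$ semi-cubes, labelled by the open inputs, lying in the standard semi-cube $Half_+\cap C_0$.) The compositions $\circ_i$ are defined, as in the little $m$-cubes operad, as substitutions of cubes; symmetric groups permute the labels. **The poset operads $\mathcal{RK}$, $\mathcal{RK}_m$, $\mathcal{RK}'_m$.** If some $c_i=\mathfrak{op}$, $\mathcal{RK}(c_1,\dots,c_n;\mathfrak{cl})=\emptyset$. Otherwise $\mathcal{RK}(c_1,\dots,c_n;c)$ is the set of pairs $(\mu,\sigma)$ (marked by the output colour $c$) where, on the complete graph with vertices $1,\dots,n$ (vertex $i$ having colour $c_i$), $\mu_{i,j}\in\{1,2,3,\dots\}$ and $\sigma_{i,j}$ are a number and an orientation ($i\to j$ or $i\leftarrow j$) of each edge $i<j$, such that no oriented cycle has all its edges of the same number. Order: $(\mu,\sigma)\le(\mu',\sigma')$ iff for all $i<j$ either $(\mu_{i,j},\sigma_{i,j})=(\mu'_{i,j},\sigma'_{i,j})$ or $\mu_{i,j}<\mu'_{i,j}$. Symmetric groups relabel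 vertices. The composite $\gamma(\alpha;\alpha_1,\dots,\alpha_n)$ is the graph whose edges inside the $i$-th block of vertices are as in $\alpha_i$ and whose edges between vertices of blocks $i\ne j$ are as the edge $\{i,j\}$ in $\alpha$. The suboperads $\mathcal{RK}_m$ and $\mathcal{RK}'_m$ are given as follows. If the output is $\mathfrak{cl}$: all $\mu_{i,j}\le m$. If the output is $\mathfrak{op}$: $\mu_{i,j}\le m$ if both $c_i,c_j$ are closed; $\mu_{i,j}\le m-1$ if both are open; for an edge between a closed and an open vertex: in $\mathcal{RK}_m$, $\mu_{i,j}\le m$ if it is oriented from the closed to the open vertex and $\mu_{i,j}\le m-1$ if oriented from the open to the closed vertex; in $\mathcal{RK}'_m$, $\mu_{i,j}\le m-1$ if oriented from the closed to the open vertex and $\mu_{i,j}\le m$ if oriented from the open to the closed vertex. **Cellular operads.** For a poset $A$ and a space $X$, an $A$-cellulation of $X$ is a functor $\Theta:A\to\mathbf{Top}$ such that $\mathrm{colim}_{\alpha\in A}\Theta(\alpha)\cong X$; for each $\alpha$ the canonical map $\mathrm{colim}_{\beta<\alpha}\Theta(\beta)\to\Theta(\alpha)$ is a closed cofibration; and each $\Theta(\alpha)$ is contractible. For a poset SC type operad $\mathcal A$, a topological SC type operad $\mathcal O$ is $\mathcal A$-cellular if each $\mathcal O(c_1,\dots,c_n;c)$ has an $\mathcal A(c_1,\dots,c_n;c)$-cellulation $\Theta_{c_1,\dots,c_n;c}$ such that $\Theta(\sigma\cdot\alpha)=\sigma\cdot\Theta(\alpha)$ for all permutations $\sigma$, and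 $\gamma^{\mathcal O}(\Theta(\alpha)\times\Theta(\alpha_1)\times\dots\times\Theta(\alpha_n))\subseteq\Theta(\gamma^{\mathcal A}(\alpha;\alpha_1,\dots,\alpha_n))$ whenever defined.
   Formalization: The profile with no input and open output (empty space, one-element poset) and compositions into it are exempt; disjoint means disjoint interiors; the point of SC_m(cl;op) composes via an arbitrary cube in the upper half; associativity and units are not recorded. *)

(* Defs.v *)
From HB Require Import structures.
From mathcomp Require Import all_boot all_order all_algebra.
From mathcomp Require Import perm ring lra.
From mathcomp Require Import all_classical all_reals all_analysis.

Set Implicit Arguments.
Unset Strict Implicit.
Unset Printing Implicit Defensive.

Import Order.TTheory GRing.Theory Num.Theory.
Import numFieldNormedType.Exports.

Local Open Scope classical_set_scope.
Local Open Scope ring_scope.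

Variant colour := cl | op.

(* [(s . c) i = c (s^-1 i)]: the colours after permuting the inputs by [s]. *)
Definition perm_colours n (s : 'S_n) (c : 'I_n -> colour) : 'I_n -> colour :=
  fun i => c ((s^-1)%g i).

(* The inputs of a total composite, numbered block after block: [tagnat.sig]  *)
(* is the order isomorphism from ['I_(\sum_i k i)] to the lexicographically   *)
(* ordered pairs (block, position in the block).                              *)
Definition comp_colours n (k : 'I_n -> nat) (d : forall i, 'I_(k i) -> colour) :
    'I_(\sum_i k i)%N -> colour :=
  fun l => d (tagnat.sig1 l) (tagnat.sig2 l).

Definition nullary_open (n : nat) (c0 : colour) : Prop := n = 0%N /\ c0 = op.

(* Both records carry the symmetric group actions and the total compositions, *)
(* which is all that the notion of cellular operad involves.                  *)
Record poset_sc_operad := PosetScOperad {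
  cell : forall n, ('I_n -> colour) -> colour -> Type;
  cle : forall n (c : 'I_n -> colour) c0, cell c c0 -> cell c c0 -> Prop;
  cact : forall n (c : 'I_n -> colour) c0 (s : 'S_n),
    cell c c0 -> cell (perm_colours s c) c0;
  ccomp : forall n (c : 'I_n -> colour) c0 (k : 'I_n -> nat)
    (d : forall i, 'I_(k i) -> colour),
    cell c c0 -> (forall i, cell (d i) (c i)) -> cell (comp_colours d) c0;
  cell_sc : forall n (c : 'I_n -> colour) i, c i = op -> cell c cl -> False;
  cle_refl : forall n (c : 'I_n -> colour) c0 (a : cell c c0), cle a a;
  cle_anti : forall n (c : 'I_n -> colour) c0 (a b : cell c c0),
    cle a b -> cle b a -> a = b;
  cle_trans : forall n (c : 'I_n -> colour) c0 (a b e : cell c c0),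
    cle a b -> cle b e -> cle a e;
  cact_mono : forall n (c : 'I_n -> colour) c0 (s : 'S_n) (a b : cell c c0),
    cle a b -> cle (cact s a) (cact s b);
  ccomp_mono : forall n (c : 'I_n -> colour) c0 (k : 'I_n -> nat)
    (d : forall i, 'I_(k i) -> colour) (a b : cell c c0)
    (aa bb : forall i, cell (d i) (c i)),
    cle a b -> (forall i, cle (aa i) (bb i)) -> cle (ccomp a aa) (ccomp b bb) }.

(* Nothing can be composed into the profile with open output and no input,    *)
(* whose component in the Swiss Cheese operad is empty although the operad    *)
(* has operations from closed inputs to the open output as well as an         *)
(* operation without input and with closed output.                            *)
Record top_sc_operad := TopScOperad {
  tspace : forall n, ('I_n -> colour) -> colour -> topologicalType;
  tact : forall n (c : 'I_n -> colour) c0 (s : 'S_n),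
    tspace c c0 -> tspace (perm_colours s c) c0;
  tcomp : forall n (c : 'I_n -> colour) c0 (k : 'I_n -> nat)
    (d : forall i, 'I_(k i) -> colour),
    ~ nullary_open (\sum_i k i) c0 ->
    tspace c c0 -> (forall i, tspace (d i) (c i)) -> tspace (comp_colours d) c0;
  tspace_sc : forall n (c : 'I_n -> colour) i, c i = op -> tspace c cl -> False;
  tact_continuous : forall n (c : 'I_n -> colour) c0 (s : 'S_n),
    continuous (@tact n c c0 s);
  tcomp_continuous : forall n (c : 'I_n -> colour) c0 (k : 'I_n -> nat)
    (d : forall i, 'I_(k i) -> colour)
    (h : ~ nullary_open (\sum_i k i) c0),
    continuous (fun p : tspace c c0 *
        prod_topology (fun i => tspace (d i) (c i)) =>
      tcomp h p.1 p.2) }.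

Record diagram (I : Type) (le : I -> I -> Prop) := Diagram {
  dobj :> I -> topologicalType;
  dmap : forall i j, le i j -> dobj i -> dobj j;
  dmap_continuous : forall i j (h : le i j), continuous (dmap h);
  dmap_id : forall i (h : le i i) x, dmap h x = x;
  dmap_comp : forall i j k (hij : le i j) (hjk : le j k) (hik : le i k) x,
    dmap hjk (dmap hij x) = dmap hik x }.

Section Diagrams.
Context {I : Type} {le : I -> I -> Prop}.

Definition sub_le (P : I -> Prop) (a b : {i | P i}) : Prop :=
  le (sval a) (sval b).

Definition restrict (F : diagram le) (P : I -> Prop) : diagram (@sub_le P) :=
  @Diagram _ (@sub_le P) (fun i => F (sval i)) (fun i j h => @dmap _ _ F _ _ h)
    (fun i j h => @dmap_continuous _ _ F _ _ h)
    (fun i h x => @dmap_id _ _ F _ h x)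
    (fun i j k hij hjk hik x => @dmap_comp _ _ F _ _ _ hij hjk hik x).

Definition is_cocone (F : diagram le) (X : topologicalType)
    (inj : forall i, F i -> X) : Prop :=
  (forall i, continuous (inj i)) /\
  (forall i j (h : le i j) x, inj j (dmap h x) = inj i x).

Definition is_colimit (F : diagram le) (X : topologicalType)
    (inj : forall i, F i -> X) : Prop :=
  is_cocone inj /\
  forall (Y : topologicalType) (f : forall i, F i -> Y), is_cocone f ->
    exists! u : X -> Y, continuous u /\ forall i x, u (inj i x) = f i x.

End Diagrams.

Section Homotopy.
Variable R : realType.

Definition unitI : topologicalType := set_type [set t : R | 0 <= t <= 1].

Lemma unitI0P : (0 : R) \in [set t : R | 0 <= t <= 1].
Proof. by rewrite inE /= lexx ler01. Qed.

Lemma unitI1P : (1 : R) \in [set t : R | 0 <= t <= 1].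
Proof. by rewrite inE /= lexx ler01. Qed.

Definition I0 : unitI := exist _ 0 unitI0P.
Definition I1 : unitI := exist _ 1 unitI1P.

Definition contractible (X : topologicalType) : Prop :=
  exists (x0 : X) (H : X * unitI -> X), continuous H /\
    forall x, H (x, I0) = x /\ H (x, I1) = x0.

Definition cofibration (A X : topologicalType) (f : A -> X) : Prop :=
  continuous f /\
  forall (Y : topologicalType) (g : X -> Y) (H : A * unitI -> Y),
    continuous g -> continuous H -> (forall a, H (a, I0) = g (f a)) ->
    exists K : X * unitI -> Y, [/\ continuous K,
      forall x, K (x, I0) = g x & forall a t, K (f a, t) = H (a, t)].

Definition closed_cofibration (A X : topologicalType) (f : A -> X) : Prop :=
  cofibration f /\ closed (range f).

Section Cellulation.
Context {I : Type} {le : I -> I -> Prop}.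

Definition below (a b : I) : Prop := le b a /\ b <> a.

Definition latching_closed_cofibration (F : diagram le) (a : I) : Prop :=
  exists (L : topologicalType)
         (inj : forall b : {b | below a b}, restrict F (below a) b -> L)
         (lam : L -> F a),
    [/\ is_colimit inj,
        forall (b : {b | below a b}) (h : le (sval b) a) x,
          lam (inj b x) = dmap h x
      & closed_cofibration lam].

Definition is_cellulation (F : diagram le) (X : topologicalType)
    (inj : forall a, F a -> X) : Prop :=
  is_colimit inj /\
  forall a, latching_closed_cofibration F a /\ contractible (F a).

End Cellulation.

(* The cell of [a] is the image [range (inj a)] in the space of operations.   *)
(* The profile with open output and no input is exempt: there the component   *)
(* of the Swiss Cheese operad is empty while that of RK is a single element,  *)
(* and the empty space has no cellulation by a nonempty poset.                *)
Definition cellular (A : poset_sc_operad) (O : top_sc_operad) : Prop :=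
  exists (Theta : forall n (c : 'I_n -> colour) c0, diagram (@cle A n c c0))
         (inj : forall n (c : 'I_n -> colour) c0 (a : cell A c c0),
            Theta n c c0 a -> tspace O c c0),
  [/\ forall n (c : 'I_n -> colour) c0, ~ nullary_open n c0 ->
        is_cellulation (inj n c c0),
      forall n (c : 'I_n -> colour) c0 (s : 'S_n) (a : cell A c c0),
        range (inj n _ c0 (cact s a)) = tact s @` range (inj n c c0 a)
    & forall n (c : 'I_n -> colour) c0 (k : 'I_n -> nat)
        (d : forall i, 'I_(k i) -> colour)
        (a : cell A c c0) (aa : forall i, cell A (d i) (c i))
        (h : ~ nullary_open (\sum_i k i) c0)
        (x : tspace O c c0) (y : forall i, tspace O (d i) (c i)),
        range (inj n c c0 a) x ->
        (forall i, range (inj (k i) (d i) (c i) (aa i)) (y i)) ->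
        range (inj _ _ c0 (ccomp a aa)) (tcomp h x y)].

End Homotopy.

(* [a (i, j) = (number of the edge {i,j}, is it oriented from i to j?)], with *)
(* the dummy value (0, false) on the diagonal.                                *)
Definition graph n := {ffun 'I_n * 'I_n -> nat * bool}.

Section RK.
Context {n : nat}.
Implicit Types a b : graph n.

Definition edge_num a i j : nat := (a (i, j)).1.
Definition edge_arr a i j : bool := (a (i, j)).2.

Definition edge_axiom a : Prop :=
  (forall i, a (i, i) = (0%N, false)) /\
  forall i j, i != j ->
    [/\ (0 < edge_num a i j)%N, edge_num a j i = edge_num a i j & edge_arr a j i = ~~ edge_arr a i j].

Definition acyclic a : Prop :=
  forall (k : nat) (p : seq 'I_n), p != [::] ->
    ~~ path.cycle (fun i j => edge_arr a i j && (edge_num a i j == k)) p.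

Definition graph_le a b : Prop :=
  forall i j, i != j -> a (i, j) = b (i, j) \/ (edge_num a i j < edge_num b i j)%N.

Definition graph_act (s : 'S_n) a : graph n :=
  [ffun e => a ((s^-1)%g e.1, (s^-1)%g e.2)].

End RK.

Definition graph_comp n (k : 'I_n -> nat) (a : graph n)
    (aa : forall i, graph (k i)) : graph (\sum_i k i)%N :=
  [ffun e => let u := tagnat.sig e.1 in let v := tagnat.sig e.2 in
    if tag u == tag v then aa (tag u) (tagged u, tagged_as u v)
    else a (tag u, tag v)].

(* Largest number allowed on an edge oriented from colour [u] to colour [v],  *)
(* for output colour [c0]; [prime] selects between RK_m and RK'_m.            *)
Definition RK_bound (prime : bool) (m : nat) (c0 u v : colour) : nat :=
  match c0, u, v with
  | cl, _, _ => m
  | op, cl, cl => m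
  | op, op, op => m.-1
  | op, cl, op => if prime then m.-1 else m
  | op, op, cl => if prime then m else m.-1
  end.

Definition RK_set prime m n (c : 'I_n -> colour) (c0 : colour) : set (graph n) :=
  [set a | [/\ c0 = cl -> forall i, c i = cl, edge_axiom a, acyclic a &
     forall i j, edge_arr a i j ->
       (edge_num a i j <= RK_bound prime m c0 (c i) (c j))%N]].

Lemma edge_irr n (a : graph n) i j : edge_axiom a -> edge_arr a i j -> i != j.
Proof. by case=> d _ h; apply/eqP => e; move: h; rewrite e /edge_arr d. Qed.

Lemma acyclic_path n (a : graph n) k x (p : seq 'I_n) : acyclic a ->
  p != [::] -> path (fun i j => edge_arr a i j && (edge_num a i j == k)) x p ->
  last x p != x.
Proof.
case/lastP: p => // p y ac _ hp; apply/eqP; rewrite last_rcons => e.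
by have := ac k (x :: p) isT; rewrite /= -{2}e hp.
Qed.

Section RKoperad.
Variables (prime : bool) (m : nat).

Definition RK_cell n (c : 'I_n -> colour) c0 : Type :=
  set_type (RK_set prime m c c0).

Definition RK_le n (c : 'I_n -> colour) c0 (a b : RK_cell c c0) : Prop :=
  graph_le (val a) (val b).

Lemma RK_sc n (c : 'I_n -> colour) i : c i = op -> RK_cell c cl -> False.
Proof.
by move=> ci [a] /set_mem[h _ _ _]; move: (h erefl i); rewrite ci.
Qed.

Lemma graph_le_refl n (a : graph n) : graph_le a a.
Proof. by move=> i j _; left. Qed.

Lemma RK_le_refl n (c : 'I_n -> colour) c0 (a : RK_cell c c0) : RK_le a a.
Proof. exact: graph_le_refl. Qed.

Lemma RK_le_anti n (c : 'I_n -> colour) c0 (a b : RK_cell c c0) :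
  RK_le a b -> RK_le b a -> a = b.
Proof.
case: a b => [a Ha] [b Hb] ab ba.
suff e : a = b by subst b; rewrite (bool_irrelevance Ha Hb).
apply/ffunP => -[i j].
have [_ [Da _] _ _] := set_mem Ha; have [_ [Db _] _ _] := set_mem Hb.
have [<-|ij] := eqVneq i j; first by rewrite Da Db.
case: (ab i j ij) => //= h1; case: (ba i j ij) => //= h2.
by move: (ltn_trans h1 h2); rewrite ltnn.
Qed.

Lemma RK_le_trans n (c : 'I_n -> colour) c0 (a b e : RK_cell c c0) :
  RK_le a b -> RK_le b e -> RK_le a e.
Proof.
move=> ab be i j ij; case: (ab i j ij) => h1; case: (be i j ij) => h2.
- by left; rewrite h1.
- by right; rewrite /edge_num h1.
- by right; rewrite /edge_num -h2.
- by right; exact: ltn_trans h1 h2.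
Qed.

Lemma graph_act_num n s (a : graph n) i j :
  edge_num (graph_act s a) i j = edge_num a ((s^-1)%g i) ((s^-1)%g j).
Proof. by rewrite /edge_num ffunE. Qed.

Lemma graph_act_arr n s (a : graph n) i j :
  edge_arr (graph_act s a) i j = edge_arr a ((s^-1)%g i) ((s^-1)%g j).
Proof. by rewrite /edge_arr ffunE. Qed.

Lemma RK_act_proof n (c : 'I_n -> colour) c0 (s : 'S_n) (a : RK_cell c c0) :
  graph_act s (val a) \in RK_set prime m (perm_colours s c) c0.
Proof.
case: a => a /set_mem[/= hc [D E] ac bd]; apply/mem_set; split.
- by move=> e i; exact: hc.
- split=> [i|i j ij]; first by rewrite ffunE D.
  rewrite !graph_act_num !graph_act_arr; apply: E.
  by apply: contra_neq ij; exact: perm_inj.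
- move=> k p p0; have := ac k (map (s^-1)%g p).
  rewrite cycle_map; case: p p0 => // x p _ /(_ isT); apply: contraNN.
  by apply: sub_cycle => i j; rewrite graph_act_num graph_act_arr.
- move=> i j; rewrite graph_act_num graph_act_arr; exact: bd.
Qed.

Definition RK_act n (c : 'I_n -> colour) c0 (s : 'S_n) (a : RK_cell c c0) :
  RK_cell (perm_colours s c) c0 := 
  exist (fun b => b \in RK_set prime m (perm_colours s c) c0) _
    (RK_act_proof s a).

Lemma RK_act_mono n (c : 'I_n -> colour) c0 (s : 'S_n) (a b : RK_cell c c0) :
  RK_le a b -> RK_le (RK_act s a) (RK_act s b).
Proof.
move=> ab i j ij; rewrite /= !graph_act_num !ffunE; apply: ab.
by apply: contra_neq ij; exact: perm_inj.
Qed.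

Section Comp.
Variables (n : nat) (k : 'I_n -> nat).
Variables (a : graph n) (aa : forall i, graph (k i)).

Lemma graph_comp_Rank i (u v : 'I_(k i)) :
  graph_comp a aa (tagnat.Rank _ u, tagnat.Rank _ v) = aa i (u, v).
Proof. by rewrite ffunE /= /tagnat.Rank !tagnat.rankK /= eqxx tagged_asE. Qed.

Lemma graph_comp_RankN i j (u : 'I_(k i)) (v : 'I_(k j)) : i != j ->
  graph_comp a aa (tagnat.Rank _ u, tagnat.Rank _ v) = a (i, j).
Proof. by move=> ij; rewrite ffunE /= /tagnat.Rank !tagnat.rankK /= ifN. Qed.

Lemma RankP l : {i : 'I_n & {u : 'I_(k i) | l = tagnat.Rank _ u}}.
Proof. by exists (tagnat.sig1 l), (tagnat.sig2 l); rewrite tagnat.sig2K. Qed.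

Lemma Rank_inj i (u v : 'I_(k i)) :
  tagnat.Rank _ u = tagnat.Rank _ v -> u = v.
Proof.
move=> /(congr1 val)/eqP; rewrite tagnat.eq_Rank eqxx /= => /eqP.
exact: val_inj.
Qed.

Lemma graph_comp_edge : edge_axiom a -> (forall i, edge_axiom (aa i)) ->
  edge_axiom (graph_comp a aa).
Proof.
move=> [D E] H; split=> [l|l l'].
  by case: (RankP l) => i [u ->]; rewrite graph_comp_Rank (H i).1.
case: (RankP l) => i [u ->]; case: (RankP l') => j [v ->].
have [e|ij _] := eqVneq i j.
  subst j => uv; rewrite /edge_num /edge_arr !graph_comp_Rank; apply: (H i).2.
  by apply: contra_neq uv => ->.
by have := E i j ij; rewrite /edge_num /edge_arr !graph_comp_RankN // eq_sym.
Qed.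

Lemma graph_comp_path q i (u : 'I_(k i)) (p : seq 'I_(\sum_i k i)%N) :
  edge_axiom a ->
  path (fun x y => edge_arr (graph_comp a aa) x y && (edge_num (graph_comp a aa) x y == q))
    (tagnat.Rank _ u) p ->
  (exists p' : seq 'I_(k i), p = map (@tagnat.Rank n k i) p' /\
     path (fun x y => edge_arr (aa i) x y && (edge_num (aa i) x y == q)) u p') \/
  (exists p' : seq 'I_n, [/\ p' != [::],
     path (fun x y => edge_arr a x y && (edge_num a x y == q)) i p' &
     last i p' = tagnat.sig1 (last (tagnat.Rank _ u) p)]).
Proof.
move=> ea; elim: p i u => [|l p IH] i u /=; first by left; exists [::].
case: (RankP l) => j [v ->{l}] /andP[uv hp].
have {IH} := IH j v hp.
have [e|ij] := eqVneq i j.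
  subst j; move: uv; rewrite /edge_arr /edge_num !graph_comp_Rank => uv.
  case=> [[p' [-> hp']]|[p' [p0 hp' hl]]].
    by left; exists (v :: p') => /=; rewrite uv.
  by right; exists p'.
move: uv; rewrite /edge_arr /edge_num !graph_comp_RankN // => uv.
case=> [[p' [-> hp']]|[p' [p0 hp' hl]]]; right.
  exists [:: j]; split => //=; first by rewrite uv.
  by rewrite last_map tagnat.Rank1K.
by exists (j :: p'); split => //=; rewrite uv.
Qed.

Lemma graph_comp_acyclic : edge_axiom a -> acyclic a ->
  (forall i, acyclic (aa i)) -> acyclic (graph_comp a aa).
Proof.
move=> ea ac H q [//|l p] _; apply/negP => /=.
case: (RankP l) => i [u ->] hp.
case: (graph_comp_path ea hp) => [[p' [e hp']]|[p' [p0 hp' hl]]].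
- case/lastP: p' e hp' => [|p' v].
    by move/(congr1 size); rewrite size_rcons.
  rewrite map_rcons => /(congr1 (last (tagnat.Rank _ u))).
  rewrite !last_rcons => /(@Rank_inj i) <- hp'.
  by have := H i q (u :: p') isT; rewrite /= hp'.
- have := acyclic_path ac p0 hp'.
  by rewrite hl last_rcons tagnat.Rank1K eqxx.
Qed.

End Comp.

Lemma RK_comp_proof n (c : 'I_n -> colour) c0 (k : 'I_n -> nat)
    (d : forall i, 'I_(k i) -> colour) (a : RK_cell c c0)
    (aa : forall i, RK_cell (d i) (c i)) :
  graph_comp (val a) (fun i => val (aa i)) \in
    RK_set prime m (comp_colours d) c0.
Proof.
case: a => a /set_mem[/= hc ea ac bd].
have H i := set_mem (valP (aa i)).
apply/mem_set; split.
- move=> e l; have [h _ _ _] := H (tagnat.sig1 l).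
  by apply: h; exact: hc.
- by apply: graph_comp_edge => // i; have [] := H i.
- by apply: graph_comp_acyclic => // i; have [] := H i.
- move=> l l'; rewrite /comp_colours.
  case: (RankP l) => i [u ->]; case: (RankP l') => j [v ->].
  have dE i0 (w : 'I_(k i0)) :
      d (tagnat.sig1 (tagnat.Rank _ w)) (tagnat.sig2 (tagnat.Rank _ w)) = d i0 w.
    suff h (t : {i0 & 'I_(k i0)}) : t = Tagged (fun i0 => 'I_(k i0)) w ->
        d (tag t) (tagged t) = d i0 w.
      by apply: h; rewrite /tagnat.Rank tagnat.rankK.
    by move=> ->.
  rewrite !dE.
  have Hcl i0 (w : 'I_(k i0)) : c i0 = cl -> d i0 w = cl.
    by move=> e; have [h _ _ _] := H i0; exact: h.
  have [e|ij] := eqVneq i j.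
    subst j; rewrite /edge_arr /edge_num graph_comp_Rank => uv.
    have [_ _ _ /(_ u v uv)] := H i; rewrite /edge_num => b.
    apply: leq_trans b _; move: (Hcl i u) (Hcl i v) (hc ^~ i).
    case: (c i) => hu hv; last by case: c0 {bd hc} => // /(_ erefl).
    by rewrite hu // hv //; case: c0 {bd hc}.
  rewrite /edge_arr /edge_num graph_comp_RankN // => uv.
  have := bd _ _ uv; rewrite /edge_num => b; apply: leq_trans b _.
  move: (Hcl i u) (Hcl j v); case: c0 {bd hc} => //=.
  case: (c i) => [/(_ erefl) ->|_]; case: (c j) => [/(_ erefl) ->|_] //;
    case: prime; try case: (d i u); try case: (d j v); by rewrite ?leq_pred.
Qed.

Definition RK_comp n (c : 'I_n -> colour) c0 (k : 'I_n -> nat)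
    (d : forall i, 'I_(k i) -> colour) (a : RK_cell c c0)
    (aa : forall i, RK_cell (d i) (c i)) : RK_cell (comp_colours d) c0 :=
  exist (fun b => b \in RK_set prime m (comp_colours d) c0) _
    (RK_comp_proof a aa).

Lemma RK_comp_mono n (c : 'I_n -> colour) c0 (k : 'I_n -> nat)
    (d : forall i, 'I_(k i) -> colour) (a b : RK_cell c c0)
    (aa bb : forall i, RK_cell (d i) (c i)) :
  RK_le a b -> (forall i, RK_le (aa i) (bb i)) ->
  RK_le (RK_comp a aa) (RK_comp b bb).
Proof.
move=> ab H l l' /=; case: (RankP l) => i [u ->]; case: (RankP l') => j [v ->].
have [e|ij _] := eqVneq i j.
  subst j => uv; rewrite /edge_num !graph_comp_Rank; apply: H.
  by apply: contra_neq uv => ->.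
by rewrite /edge_num !graph_comp_RankN //; exact: ab.
Qed.

Definition RK_operad_gen : poset_sc_operad :=
  @PosetScOperad RK_cell RK_le RK_act RK_comp RK_sc RK_le_refl RK_le_anti
    RK_le_trans RK_act_mono RK_comp_mono.

End RKoperad.

Definition RK (m : nat) : poset_sc_operad := RK_operad_gen false m.
Definition RK' (m : nat) : poset_sc_operad := RK_operad_gen true m.

Section SwissCheese.
Variables (R : realType) (m : nat).

(* The box with lower corner [b.1] and upper corner [b.2]. *)
Definition cube : topologicalType := ('rV[R]_m * 'rV[R]_m)%type.

Definition config n : topologicalType := 'rV['rV[R]_m * 'rV[R]_m]_n.

Definition cube_at n (C : config n) (i : 'I_n) : cube := C 0 i.

Definition box (b : cube) : set 'rV[R]_m :=
  [set x | forall j, b.1 0 j <= x 0 j <= b.2 0 j].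

Definition box_interior (b : cube) : set 'rV[R]_m :=
  [set x | forall j, b.1 0 j < x 0 j < b.2 0 j].

Definition Sym (x : 'rV[R]_m) : 'rV[R]_m :=
  \row_j (if j.+1 == m then - x 0 j else x 0 j).

Definition Half_plus : set 'rV[R]_m :=
  [set x | forall j : 'I_m, j.+1 = m -> 0 < x 0 j].

(* May's little cubes, with [-1,1]^m as the unit cube instead of [0,1]^m. *)
Definition little_cubes n : set (config n) :=
  [set C |
    (forall i j, [/\ -1 <= (cube_at C i).1 0 j,
       (cube_at C i).1 0 j < (cube_at C i).2 0 j & (cube_at C i).2 0 j <= 1]) /\
    (forall i i', i != i' ->
       box_interior (cube_at C i) `&` box_interior (cube_at C i') = set0)].

Definition in_standard_cube (b : cube) : Prop :=
  forall j, [/\ -1 < b.1 0 j, b.1 0 j < b.2 0 j & b.2 0 j < 1].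

(* The 2s+t cubes of a configuration are indexed by the pairs (i, false), for *)
(* all inputs i, together with the pairs (i, true), for the closed inputs i.  *)
(* The latter are the mirror images, determined by the former, so that only   *)
(* the cubes (i, false) are recorded in a [config].                           *)
Definition cube_index n (c : 'I_n -> colour) (u : 'I_n * bool) : Prop :=
  u.2 -> c u.1 = cl.

Definition piece_interior n (C : config n) (u : 'I_n * bool) : set 'rV[R]_m :=
  if u.2 then Sym @` box_interior (cube_at C u.1)
  else box_interior (cube_at C u.1).

(* Cubes are disjoint when their interiors are, as for little cubes: this is  *)
(* what makes substitution of little cubes possible.                          *)
Definition symmetric_configs n (c : 'I_n -> colour) : set (config n) :=
  [set C |
    [/\ forall i, in_standard_cube (cube_at C i),
        forall i, c i = cl -> box (cube_at C i) `<=` Half_plus,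
        forall i, c i = op -> Sym @` box (cube_at C i) = box (cube_at C i)
      & forall u v, cube_index c u -> cube_index c v -> u <> v ->
          piece_interior C u `&` piece_interior C v = set0]].

Definition upper_cube : Type :=
  {q : cube | in_standard_cube q /\ box q `<=` Half_plus}.

Lemma upper_cube_inhabited : inhabited upper_cube.
Proof.
constructor.
exists (\row_j (if j.+1 == m then 4^-1 else - 2^-1), const_mx 2^-1).
split=> [j|x bx j jm]; first by rewrite /= !mxE; case: ifP => _; split; lra.
by have /andP[] := bx j; rewrite /= !mxE jm eqxx => ? _; lra.
Qed.

Section Operad.
Variable q : upper_cube.

(* The elements of the one-point spaces with one input and open output are    *)
(* named by a cube so that substitution makes sense for them: the standard    *)
(* cube for an open input (the unit), and [q] for a closed input, where any   *)
(* choice of [q] makes the substitution of little cubes fall in the right     *)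
(* space.                                                                     *)
Definition standard_cube (u : colour) : cube :=
  if u is cl then sval q else (const_mx (-1), const_mx 1).

Definition standard_config n (c : 'I_n -> colour) : config n :=
  \row_i (standard_cube (c i) : 'rV[R]_m * 'rV[R]_m).

Definition SC_set n (c : 'I_n -> colour) (c0 : colour) : set (config n) :=
  match c0 with
  | cl => [set C | (forall i, c i = cl) /\ little_cubes C]
  | op => if n == 0%N then set0
          else if n == 1%N then [set standard_config c]
          else symmetric_configs c
  end.

Definition SC_space n (c : 'I_n -> colour) (c0 : colour) : topologicalType :=
  set_type (SC_set c c0).

Definition config_act n (s : 'S_n) (C : config n) : config n :=
  \row_i (cube_at C ((s^-1)%g i) : 'rV[R]_m * 'rV[R]_m).

(* The affine map, coordinate by coordinate, from [-1,1]^m onto [box b]. *)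
Definition affine_into (b : cube) (x : 'rV[R]_m) : 'rV[R]_m :=
  \row_j (b.1 0 j + (b.2 0 j - b.1 0 j) * ((x 0 j + 1) / 2)).

Definition subst_cube (b b' : cube) : cube :=
  (affine_into b b'.1, affine_into b b'.2).

Definition subst_config n (k : 'I_n -> nat) (C : config n)
    (D : forall i, config (k i)) : config (\sum_i k i)%N :=
  \row_l (subst_cube (cube_at C (tagnat.sig1 l))
     (cube_at (D (tagnat.sig1 l)) (tagnat.sig2 l)) : 'rV[R]_m * 'rV[R]_m).

Definition comp_config n (c0 : colour) (k : 'I_n -> nat)
    (d : forall i, 'I_(k i) -> colour) (C : config n)
    (D : forall i, config (k i)) : config (\sum_i k i)%N :=
  if c0 is op then
    if (\sum_i k i)%N == 1%N then standard_config (comp_colours d)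
    else subst_config C D
  else subst_config C D.

Lemma SC_empty n (c : 'I_n -> colour) i : c i = op -> SC_space c cl -> False.
Proof. by move=> ci [x /set_mem[/(_ i)]]; rewrite ci. Qed.

Lemma sym_boxP (b : cube) : (forall j, b.1 0 j < b.2 0 j) ->
  (Sym @` box b = box b <-> forall j : 'I_m, j.+1 = m -> b.1 0 j = - b.2 0 j).
Proof.
move=> lt; split=> [E j jm|E].
  have h1 : box b (Sym b.1).
    by rewrite -E; exists b.1 => // i; rewrite lexx ltW.
  have h2 : box b (Sym b.2).
    by rewrite -E; exists b.2 => // i; rewrite lexx ltW.
  have /andP[_] := h1 j; have /andP[+ _] := h2 j.
  by rewrite !mxE jm eqxx => ? ?; apply/eqP; rewrite eq_le; lra.
have S x : box b x -> box b (Sym x).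
  move=> bx j; have /andP[] := bx j; rewrite mxE; case: eqP => [jm|_].
    by rewrite (E _ jm); lra.
  by move=> -> ->.
apply/seteqP; split=> [_ [x bx <-]|x bx]; first exact: S.
exists (Sym x); first exact: S.
by apply/rowP => j; rewrite !mxE; case: eqP => // _; rewrite opprK.
Qed.

Lemma half_boxP (b : cube) : (forall j, b.1 0 j < b.2 0 j) ->
  (box b `<=` Half_plus <-> forall j : 'I_m, j.+1 = m -> 0 < b.1 0 j).
Proof.
move=> lt; split=> [H j jm|H x bx j jm].
  by apply: (H b.1) jm => i; rewrite lexx ltW.
by have /andP[h _] := bx j; exact: lt_le_trans (H j jm) h.
Qed.

Definition good n (c : 'I_n -> colour) (C : config n) : Prop :=
  [/\ little_cubes C,
      forall i, c i = cl -> forall j : 'I_m, j.+1 = m -> 0 < (cube_at C i).1 0 j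
    & forall i, c i = op -> forall j : 'I_m, j.+1 = m ->
        (cube_at C i).1 0 j = - (cube_at C i).2 0 j].

Lemma symmetric_good n (c : 'I_n -> colour) (C : config n) :
  symmetric_configs c C -> good c C.
Proof.
case=> S Hcl Hop P; split.
- split=> [i j|i i' ii']; first by have [h1 h2 h3] := S i j; rewrite !ltW.
  by apply: (P (i, false) (i', false)) => // -[e]; rewrite e eqxx in ii'.
- by move=> i /Hcl /half_boxP; apply => j; have [] := S i j.
- by move=> i /Hop /sym_boxP; apply => j; have [] := S i j.
Qed.

Lemma good_symmetric n (c : 'I_n -> colour) (C : config n) : (1 < n)%N ->
  (forall i, in_standard_cube (cube_at C i)) -> good c C ->
  symmetric_configs c C.
Proof.
move=> n1 S [[_ P] Hcl Hop].
have lt i j : (cube_at C i).1 0 j < (cube_at C i).2 0 j by have [] := S i j.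
have [m0|m0] := posnP m.
  pose z : 'rV[R]_m := 0.
  have bz i : box_interior (cube_at C i) z.
    by move=> [j hj]; exfalso; move: hj; rewrite m0.
  have /seteqP[/(_ z) h _] := P (Ordinal (ltnW n1)) (Ordinal n1) isT.
  by case: h.
have jl : (m.-1 < m)%N by rewrite prednK.
pose J : 'I_m := Ordinal jl.
have Jm : J.+1 = m by rewrite /= prednK.
have SymK x : Sym (Sym x) = x.
  by apply/rowP => j; rewrite !mxE; case: eqP => // _; rewrite opprK.
have Sop i x : c i = op -> box_interior (cube_at C i) x ->
    box_interior (cube_at C i) (Sym x).
  move=> ci bx j; have /andP[] := bx j; rewrite mxE; case: eqP => [jm|_].
    by rewrite (Hop _ ci _ jm); lra.
  by move=> -> ->.
have X i i' : box_interior (cube_at C i) `&` Sym @` box_interior (cube_at C i')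
    = set0 \/ c i' = op.
  case E' : (c i'); last by right.
  left; case E : (c i).
    rewrite -subset0 => z [/= bx [x bx' e]]; move: bx; rewrite -e => bx.
    have /andP[h _] := bx' J; have /andP[h' _] := bx J.
    move: h'; rewrite mxE Jm eqxx.
    move: (Hcl _ E _ Jm) (Hcl _ E' _ Jm); move: h; lra.
  rewrite -subset0 => z [/= bx [x bx' e]].
  have ii' : i != i' by apply/eqP => e'; move: E; rewrite e' E'.
  have /seteqP[/(_ x) h _] := P _ _ ii'; apply: h; split => //.
  by rewrite -(SymK x) e; exact: Sop.
split=> //.
- by move=> i ci; apply/half_boxP => //; exact: Hcl.
- by move=> i ci; apply/sym_boxP => //; exact: Hop.
move=> [i [] ] [i' [] ] /= hu hv uv; rewrite /piece_interior /=.
- have ii' : i != i' by apply: contra_notN uv => /eqP ->.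
  rewrite -subset0 => z [[x bx <-] [y bx' /(congr1 Sym)]].
  rewrite !SymK => e; subst y.
  by have /seteqP[/(_ x) h _] := P _ _ ii'; apply: h.
- by rewrite setIC; case: (X i' i) => // e; move: (hu isT) => /=; rewrite e.
- by case: (X i i') => // e; move: (hv isT) => /=; rewrite e.
- by apply: P; apply: contra_notN uv => /eqP ->.
Qed.

Lemma ord_uniq1 n (i i' : 'I_n) : n = 1%N -> i = i'.
Proof. by move=> n1; subst n; rewrite !ord1. Qed.

Lemma SC_op_good n (c : 'I_n -> colour) (C : config n) :
  SC_set c op C -> good c C.
Proof.
rewrite /SC_set; case: eqP => // _; case: eqP => [n1 ->|_]; last first.
  exact: symmetric_good.
have E i : cube_at (standard_config c) i = standard_cube (c i).
  by rewrite /cube_at mxE.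
have [Q1 Q2] := svalP q; have lt j : (sval q).1 0 j < (sval q).2 0 j.
  by have [] := Q1 j.
split.
- split=> [i j|i i'].
    rewrite E; case: (c i) => /=; first by have [h1 h2 h3] := Q1 j; rewrite !ltW.
    by rewrite !mxE !lexx; split => //; lra.
  by rewrite (ord_uniq1 i i' n1) eqxx.
- by move=> i ci j jm; rewrite E ci /=; have /half_boxP := Q2; apply.
- by move=> i ci j jm; rewrite E ci /= !mxE.
Qed.

Lemma cube_at_subst n (k : 'I_n -> nat) (C : config n)
    (D : forall i, config (k i)) i (u : 'I_(k i)) :
  cube_at (subst_config C D) (tagnat.Rank _ u) =
  subst_cube (cube_at C i) (cube_at (D i) u).
Proof.
rewrite {1}/cube_at mxE.
suff h (t : {i0 & 'I_(k i0)}) : t = Tagged (fun i0 => 'I_(k i0)) u ->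
    subst_cube (cube_at C (tag t)) (cube_at (D (tag t)) (tagged t)) =
    subst_cube (cube_at C i) (cube_at (D i) u).
  by apply: h; rewrite /tagnat.Rank tagnat.rankK.
by move=> ->.
Qed.

Lemma subst_bounds (b b' : cube) j : b.1 0 j < b.2 0 j ->
  [/\ -1 <= b'.1 0 j, b'.1 0 j < b'.2 0 j & b'.2 0 j <= 1] ->
  [/\ b.1 0 j <= (subst_cube b b').1 0 j,
      (subst_cube b b').1 0 j < (subst_cube b b').2 0 j &
      (subst_cube b b').2 0 j <= b.2 0 j].
Proof. by move=> h [h1 h2 h3]; rewrite !mxE; split; nra. Qed.

Lemma subst_little n (k : 'I_n -> nat) (C : config n)
    (D : forall i, config (k i)) :
  little_cubes C -> (forall i, little_cubes (D i)) ->
  little_cubes (subst_config C D).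
Proof.
move=> [B P] H.
have BB i (u : 'I_(k i)) j := subst_bounds (let: And3 _ h _ := B i j in h)
  ((H i).1 u j).
split=> [l j|l l'].
  case: (RankP l) => i [u ->]; rewrite cube_at_subst.
  have [h1 h2 h3] := BB i u j; have [h4 h5 h6] := B i j.
  by split=> //; [exact: le_trans h4 h1|exact: le_trans h3 h6].
case: (RankP l) => i [u ->]; case: (RankP l') => i' [v ->] ll'.
rewrite !cube_at_subst -subset0 => x [/= hx hx'].
have [e|ii'] := eqVneq i i'.
  subst i'; have uv : u != v by apply: contra_neq ll' => ->.
  pose b := cube_at C i.
  have lt j : 0 < b.2 0 j - b.1 0 j by rewrite subr_gt0; have [] := B i j.
  have [x' K] : exists x' : 'rV[R]_m, forall j,
      x 0 j = b.1 0 j + (b.2 0 j - b.1 0 j) * ((x' 0 j + 1) / 2).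
    exists (\row_j ((x 0 j - b.1 0 j) / (b.2 0 j - b.1 0 j) * 2 - 1)) => j.
    by rewrite mxE; field; rewrite gt_eqF.
  have G w : box_interior (subst_cube b (cube_at (D i) w)) x ->
      box_interior (cube_at (D i) w) x'.
    move=> h j; have := h j; rewrite /subst_cube /affine_into !mxE.
    rewrite !K !ltrD2l !(ltr_pM2l (lt j)) !ltr_pM2r ?invr_gt0 ?ltr0n //.
    by rewrite !ltrD2r.
  by have /seteqP[/(_ x') h _] := (H i).2 _ _ uv; apply: h; split; apply: G.
have G i0 (w : 'I_(k i0)) :
    box_interior (subst_cube (cube_at C i0) (cube_at (D i0) w)) x ->
    box_interior (cube_at C i0) x.
  move=> h j; have /andP[h1 h2] := h j; have [h3 _ h4] := BB i0 w j.
  by rewrite (le_lt_trans h3 h1) (lt_le_trans h2 h4).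
by have /seteqP[/(_ x) h _] := P _ _ ii'; apply: h; split; exact: G.
Qed.

Lemma SC_comp_proof n (c : 'I_n -> colour) c0 (k : 'I_n -> nat)
    (d : forall i, 'I_(k i) -> colour)
    (h : ~ nullary_open (\sum_i k i) c0) (x : SC_space c c0)
    (y : forall i, SC_space (d i) (c i)) :
  comp_config c0 d (set_val x) (fun i => set_val (y i)) \in
    SC_set (comp_colours d) c0.
Proof.
have Hx : SC_set c c0 (set_val x) by exact: set_mem (valP x).
have Hy i : SC_set (d i) (c i) (set_val (y i)) by exact: set_mem (valP (y i)).
set C := set_val x in Hx *; set D := fun i => set_val (y i).
have HD i : SC_set (d i) (c i) (D i) by exact: Hy.
move: C Hx D HD => C HC D HD {x y Hy}.
have LD i : little_cubes (D i).
  have := HD i; case: (c i) => HH; first by case: HH.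
  by have [] := SC_op_good HH.
apply/mem_set; case: c0 h HC => [_ [hc LC]|h HC].
  split; last exact: subst_little.
  by move=> l; have := HD (tagnat.sig1 l); rewrite hc => -[dc _]; exact: dc.
rewrite /comp_config /SC_set; case: eqP => [s0|s0]; first by case: h.
case: eqP => // s1.
have s2 : (1 < \sum_i k i)%N by move: s0 s1; case: (\sum_i k i)%N => [|[]].
have [LC Ccl Cop] := SC_op_good HC.
have B i j := let: And3 _ hh _ := LC.1 i j in hh.
have Dop i : c i = op -> good (d i) (D i).
  by move=> ci; apply: SC_op_good; rewrite -ci.
have dcl i u : c i = cl -> d i u = cl.
  by move=> ci; have := HD i; rewrite ci => -[dc _]; exact: dc.
have dE i (w : 'I_(k i)) : comp_colours d (tagnat.Rank _ w) = d i w.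
  suff hh (t : {i0 & 'I_(k i0)}) : t = Tagged (fun i0 => 'I_(k i0)) w ->
      d (tag t) (tagged t) = d i w.
    by apply: hh; rewrite /tagnat.Rank tagnat.rankK.
  by move=> ->.
have aff i (j : 'I_m) t : c i = op -> j.+1 = m ->
    (affine_into (cube_at C i) t) 0 j = (cube_at C i).2 0 j * t 0 j /\
    0 < (cube_at C i).2 0 j.
  move=> ci jm; have e := Cop i ci j jm; have := B i j.
  by rewrite mxE e => lt; split; [field|lra].
apply: good_symmetric => //; last first.
  split; first exact: subst_little.
  - move=> l; case: (RankP l) => i [u ->]; rewrite dE cube_at_subst => du j jm.
    case ci : (c i).
      have [h1 _ _] := subst_bounds (B i j) ((LD i).1 u j).
      by apply: lt_le_trans h1; exact: Ccl.
    have [_ h1 _] := Dop _ ci; have [e h2] := aff i j (cube_at (D i) u).1 ci jm.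
    by rewrite /= e mulr_gt0 //; exact: h1.
  - move=> l; case: (RankP l) => i [u ->]; rewrite dE cube_at_subst => du j jm.
    case ci : (c i); first by move: du; rewrite dcl.
    have [_ _ h1] := Dop _ ci.
    have [e1 _] := aff i j (cube_at (D i) u).1 ci jm.
    have [e2 _] := aff i j (cube_at (D i) u).2 ci jm.
    by rewrite /= e1 e2 h1 // mulrN.
move=> l j; case: (RankP l) => i [u ->]; rewrite cube_at_subst.
have [h1 h2 h3] := subst_bounds (B i j) ((LD i).1 u j).
have strict : in_standard_cube (cube_at C i) ->
    [/\ -1 < (subst_cube (cube_at C i) (cube_at (D i) u)).1 0 j,
        (subst_cube (cube_at C i) (cube_at (D i) u)).1 0 j <
        (subst_cube (cube_at C i) (cube_at (D i) u)).2 0 j &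
        (subst_cube (cube_at C i) (cube_at (D i) u)).2 0 j < 1].
  move=> /(_ j)[h4 _ h5].
  by split => //; [exact: lt_le_trans h4 h1|exact: le_lt_trans h3 h5].
move: HC; rewrite /SC_set; case: eqP => // _; case: eqP => [n1 e|_]; last first.
  by case=> S _ _ _; exact: strict.
have E : cube_at C i = standard_cube (c i) by rewrite e /cube_at mxE.
case ci : (c i); first by apply: strict; rewrite E ci; exact: (svalP q).1.
have ki : (\sum_i k i)%N = k i.
  rewrite (bigD1 i) //= big1 ?addn0 // => i'.
  by rewrite (ord_uniq1 i' i n1) eqxx.
have := HD i; rewrite ci /SC_set.
case: eqP => [k0|_]; first by case: s0; rewrite ki.
case: eqP => [k1|_]; first by case: s1; rewrite ki.
case=> /(_ u j)[g1 g2 g3] _ _ _.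
by rewrite E ci /= /affine_into !mxE; split; lra.
Qed.

Definition SC_comp n (c : 'I_n -> colour) c0 (k : 'I_n -> nat)
    (d : forall i, 'I_(k i) -> colour)
    (h : ~ nullary_open (\sum_i k i) c0) (x : SC_space c c0)
    (y : forall i, SC_space (d i) (c i)) : SC_space (comp_colours d) c0 :=
  exist (fun C => C \in SC_set (comp_colours d) c0) _ (SC_comp_proof h x y).

Lemma SC_act_proof n (c : 'I_n -> colour) c0 (s : 'S_n) (x : SC_space c c0) :
  config_act s (set_val x) \in SC_set (perm_colours s c) c0.
Proof.
have Hx : SC_set c c0 (set_val x) by exact: set_mem (valP x).
move: (set_val x) Hx => C HC {x}; apply/mem_set.
have E i : cube_at (config_act s C) i = cube_at C ((s^-1)%g i).
  by rewrite {1}/cube_at mxE.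
have L : little_cubes C -> little_cubes (config_act s C).
  case=> B P; split=> [i j|i i' ii']; rewrite !E //; apply: P.
  by apply: contra_neq ii'; exact: perm_inj.
case: c0 HC => [[hc LC]|HC]; first by split; [move=> i; exact: hc|exact: L].
have [LC Ccl Cop] := SC_op_good HC.
move: HC; rewrite /SC_set; case: eqP => // n0; case: eqP => [n1 ->|n1 [S _ _ _]].
  by apply/rowP => i; rewrite mxE /cube_at mxE [RHS]mxE.
apply: good_symmetric.
- by move: n0 n1; case: (n) => [|[]].
- by move=> i; rewrite E.
split; first exact: L.
- by move=> i ci; rewrite E; exact: Ccl.
- by move=> i ci; rewrite E; exact: Cop.
Qed.

Definition SC_act n (c : 'I_n -> colour) c0 (s : 'S_n) (x : SC_space c c0) :
    SC_space (perm_colours s c) c0 :=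
  exist (fun C => C \in SC_set (perm_colours s c) c0) _ (SC_act_proof s x).

Lemma continuous_entry (T : topologicalType) a b (i : 'I_a) (j : 'I_b) :
  continuous (fun M : 'M[T]_(a, b) => M i j).
Proof.
move=> M A MA; exists (fun i' j' => [set t | i' = i -> j' = j -> A t]).
  move=> i' j'; have [->|ii'] := eqVneq i' i; last first.
    by apply: (@filterS _ _ _ setT); [move=> t _ /= e; rewrite e eqxx in ii'|
      exact: filterT].
  have [->|jj'] := eqVneq j' j; last first.
    by apply: (@filterS _ _ _ setT); [move=> t _ /= _ e; rewrite e eqxx in jj'|
      exact: filterT].
  by apply: filterS MA => t At _ _.
by move=> M' /(_ i j) /=; exact.
Qed.

Lemma continuous_row (U T : topologicalType) n (f : U -> 'rV[T]_n) :
  (forall i, continuous (fun u => f u 0 i)) -> continuous f.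
Proof.
move=> cf u A [P hP PA]; rewrite /nbhs /=.
have : \forall x \near u, forall i, P 0 i (f x 0 i).
  by apply: filter_forall => i; apply: cf; exact: hP.
by apply: filterS => x Px; apply: PA => i j; rewrite (ord1 i).
Qed.

Lemma SC_act_continuous n (c : 'I_n -> colour) c0 (s : 'S_n) :
  continuous (@SC_act n c c0 s).
Proof.
apply: continuous_comp_initial; apply: continuous_row => i x.
have E : (fun u : SC_space c c0 => (set_val \o SC_act s) u 0 i) =
    (fun C : config n => C 0 ((s^-1)%g i)) \o set_val.
  by apply/funext => u; rewrite /= /config_act mxE.
rewrite E; apply: continuous_comp; first exact: initial_continuous.
exact: continuous_entry.
Qed.

Lemma comp_config_one n c0 (k : 'I_n -> nat)
    (d : forall i, 'I_(k i) -> colour) C D :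
  c0 = op /\ (\sum_i k i)%N = 1%N ->
  comp_config c0 d C D = standard_config (comp_colours d).
Proof. by rewrite /comp_config => -[-> /eqP ->]. Qed.

Lemma comp_config_subst n c0 (k : 'I_n -> nat)
    (d : forall i, 'I_(k i) -> colour) C D :
  ~ (c0 = op /\ (\sum_i k i)%N = 1%N) -> comp_config c0 d C D = subst_config C D.
Proof.
by rewrite /comp_config; case: c0 => // e; case: eqP => // ee; case: e.
Qed.

Lemma SC_comp_continuous n (c : 'I_n -> colour) c0 (k : 'I_n -> nat)
    (d : forall i, 'I_(k i) -> colour)
    (h : ~ nullary_open (\sum_i k i) c0) :
  continuous (fun p : SC_space c c0 *
      prod_topology (fun i => SC_space (d i) (c i)) => SC_comp h p.1 p.2).
Proof.
pose P : topologicalType :=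
  (SC_space c c0 * prod_topology (fun i => SC_space (d i) (c i)))%type.
apply: continuous_comp_initial.
have [e|e] := pselect (c0 = op /\ (\sum_i k i)%N = 1%N).
  rewrite [X in continuous X](_ : _ =
    fun _ : P => standard_config (comp_colours d)); first exact: cst_continuous.
  by apply/funext => p; rewrite /= set_valE /= comp_config_one.
rewrite [X in continuous X](_ : _ =
    fun p : P => subst_config (set_val p.1) (fun i => set_val (p.2 i)));
  last by apply/funext => p; rewrite /= set_valE /= comp_config_subst.
apply: continuous_row => l.
pose i := tagnat.sig1 l; pose u := tagnat.sig2 l.
pose b (p : P) : cube := cube_at (set_val p.1) i.
pose b' (p : P) : cube := cube_at (set_val (p.2 i)) u.
have -> : (fun p : P =>
    subst_config (set_val p.1) (fun i0 => set_val (p.2 i0)) 0 l) =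
    (fun p => (affine_into (b p) (b' p).1, affine_into (b p) (b' p).2)).
  by apply/funext => p; rewrite mxE.
have cb : continuous b.
  move=> p; apply: (@continuous_comp _ _ _ (set_val \o fst)
    (fun C : config n => C 0 i)); last exact: continuous_entry.
  by apply: continuous_comp; [exact: cvg_fst|exact: initial_continuous].
have cb' : continuous b'.
  pose g (p : P) : SC_space (d i) (c i) := p.2 i.
  have cg : continuous g.
    pose K i0 : topologicalType := SC_space (d i0) (c i0).
    move=> p; have h1 : {for p, continuous (snd : P -> prod_topology K)}.
      exact: cvg_snd.
    exact: (continuous_comp h1 (@proj_continuous _ K i p.2)).
  pose gs (p : P) : config (k i) := set_val (g p).
  have cgs : continuous gs.
    move=> p; apply: (@continuous_comp _ _ _ g set_val); first exact: cg.
    exact: initial_continuous.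
  move=> p; apply: (@continuous_comp _ _ _ gs (fun C : config (k i) => C 0 u)).
    exact: cgs.
  exact: continuous_entry.
have c1 j (g : P -> cube) : continuous g -> continuous (fun p => (g p).1 0 j).
  move=> cg p; apply: (@continuous_comp _ _ _ (fst \o g)
    (fun v : 'rV[R]_m => v 0 j)); last exact: continuous_entry.
  by apply: continuous_comp; [exact: cg|exact: cvg_fst].
have c2 j (g : P -> cube) : continuous g -> continuous (fun p => (g p).2 0 j).
  move=> cg p; apply: (@continuous_comp _ _ _ (snd \o g)
    (fun v : 'rV[R]_m => v 0 j)); last exact: continuous_entry.
  by apply: continuous_comp; [exact: cg|exact: cvg_snd].
have ca (g : P -> 'rV[R]_m) : (forall j, continuous (fun p => g p 0 j)) ->
    continuous (fun p => affine_into (b p) (g p)).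
  move=> cg; apply: continuous_row => j p.
  have -> : (fun p => affine_into (b p) (g p) 0 j) = (fun p =>
     (b p).1 0 j + ((b p).2 0 j - (b p).1 0 j) * ((g p 0 j + 1) / 2)).
    by apply/funext => p'; rewrite mxE.
  apply: cvgD; first exact: c1.
  apply: cvgM; first by apply: cvgB; [exact: c2|exact: c1].
  apply: cvgMl; apply: cvgD; [exact: cg|exact: cvg_cst].
have A1 := ca _ (fun j => c1 j _ cb'); have A2 := ca _ (fun j => c2 j _ cb').
by move=> p; exact: cvg_pair (A1 p) (A2 p).
Qed.

Definition SC : top_sc_operad :=
  @TopScOperad SC_space SC_act SC_comp SC_empty SC_act_continuous
    SC_comp_continuous.

End Operad.
End SwissCheese.

(* Main.v *)
Require Import Defs.
From mathcomp Require Import all_boot all_algebra all_reals.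
From mathcomp Require Import all_order perm ring lra zify.
From mathcomp Require Import all_classical all_analysis.

(** Two boxes with disjoint interiors are separated by a hyperplane orthogonal
to some coordinate axis. To a configuration [C] one associates the graph
[config_graph C] whose edge between [i] and [j] is numbered by the least
direction in which the boxes [i] and [j] are separated, and oriented by which of
them comes first in this direction. Arrows of one number order the boxes along
one axis, so there are no cycles; and the bounds on the numbers at open vertices
express that in the last direction, where open boxes are symmetric, an open box
can only be separated from a closed one, and lies below it. This is why both RK
and RK' occur: arrows point downwards for the former and upwards for the latter.

The cell of a graph [a] consists of the configurations whose graph is at most
[a]. By [config_graph_leP] this means that every arrow of [a] from [i] to [j],
of number [k], is explained either by a separation in direction [k], in the
order given by the arrow, or by a separation in some smaller direction. Such
conditions are closed, are permuted by the symmetric groups, and are inherited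
by substitutions of cubes, so the cells are compatible with the operad
structures. Since the cells form a finite closed cover and are the unions of the
strata of the smaller graphs, the whole space, and likewise the boundary of each
cell, is the colimit of the cells that it contains ([strata_colimit]).

The boundary of the cell of [a] is where some pair of boxes is separated in a
direction smaller than the number of its edge. Shrinking all boxes about their
centres preserves separations and makes overlaps decrease at a positive rate, so
it pushes a neighbourhood of the boundary into the boundary, in a time that
depends continuously on the configuration. This gives the homotopy extension
property ([push_closed_cofibration]).

The cell of [a] is contractible ([cells_contractible]): it contains a
configuration [target] in which every arrow is explained by its own direction,
by stacking boxes along each axis according to the acyclic relation of the
arrows of that number; and any configuration of the cell can be moved to it
linearly in one direction after the other, starting with the last one, without
leaving the cell. *)

Set Implicit Arguments.
Unset Strict Implicit.
Unset Printing Implicit Defensive.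

Import Order.TTheory GRing.Theory Num.Theory.
Import numFieldNormedType.Exports.

Local Open Scope classical_set_scope.
Local Open Scope ring_scope.

(** * Gluing along finite closed covers *)

(** The index types met below are subtypes of a type of graphs, whose finiteness
is most easily expressed by an injection into a finite type. *)
Lemma closed_union_fin (X : topologicalType) (I : Type) (J : finType)
    (K : I -> J) (C : I -> set X) :
  injective K -> (forall i, closed (C i)) -> closed [set x | exists i, C i x].
Proof.
move=> injK cC.
have -> : [set x | exists i, C i x] =
    \bigcup_(j in [set: J]) [set x | exists2 i, K i = j & C i x].
  apply/seteqP; split=> [x [i Cx]|x [j _ [i _ Cx]]]; last by exists i.
  by exists (K i) => //; exists i.
apply: closed_bigcup => [|j _]; first exact: finite_finset.
have [[i <-]|nK] := pselect (exists i, K i = j).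
  rewrite (_ : [set x | _] = C i) //; apply/seteqP; split=> [x|x Cx].
    by case=> i' /injK ->.
  by exists i.
rewrite (_ : [set x | _] = set0); first exact: closed0.
by apply/seteqP; split=> // x [i Ki _]; apply: nK; exists i.
Qed.

Lemma continuous_closed_cover (X Y : topologicalType) (I : Type) (J : finType)
    (K : I -> J) (F : I -> topologicalType) (inj : forall i, F i -> X)
    (u : X -> Y) :
  injective K -> (forall i B, closed B -> closed (inj i @` B)) ->
  (forall x, exists i z, inj i z = x) ->
  (forall i, continuous (u \o inj i)) -> continuous u.
Proof.
move=> injK clinj cover cu; apply/continuous_closedP => B cB.
have -> : u @^-1` B =
    [set x | exists i, (inj i @` ((u \o inj i) @^-1` B)) x].
  apply/seteqP; split=> [x Bx|x [i [z Bz <-]]] //.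
  by have [i [z e]] := cover x; exists i, z => //=; rewrite e.
apply: (closed_union_fin injK) => i; apply: clinj.
exact: (continuous_closedP _).1 (cu i) _ cB.
Qed.

Lemma set_val_continuous (X : topologicalType) (A : set X) :
  continuous (set_val : set_type A -> X).
Proof. exact: initial_continuous. Qed.

Lemma set_val_closed_map (X : topologicalType) (A : set X) (B : set (set_type A)) :
  closed A -> closed B -> closed (set_val @` B).
Proof.
move=> cA cB; have : open (~` B) by exact: closed_openC.
case=> U oU UB.
have -> : set_val @` B = A `&` ~` U.
  apply/seteqP; split=> [_ [x Bx <-]|x [Ax nUx]].
    split; first exact: set_mem (valP x).
    by move=> Ux; have : (~` B) x by rewrite -UB.
  exists (SigSub (mem_set Ax)) => //; apply: contrapT => nB.
  by apply: nUx; have : (~` B) (SigSub (mem_set Ax)) by []; rewrite -UB.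
by apply: closedI => //; exact: open_closedC.
Qed.

Lemma continuous_pair (X Y Z : topologicalType) (f : X -> Y) (g : X -> Z) :
  continuous f -> continuous g -> continuous (fun x => (f x, g x)).
Proof. by move=> cf cg x; exact: cvg_pair (cf x) (cg x). Qed.

Lemma continuous_fun_comp (X Y Z : topologicalType) (f : X -> Y) (g : Y -> Z) :
  continuous f -> continuous g -> continuous (fun x => g (f x)).
Proof. by move=> cf cg x; exact: continuous_comp (cf x) (cg _). Qed.

Lemma continuous_to_set_type (Z X : topologicalType) (A : set X)
    (f : Z -> set_type A) : continuous (set_val \o f) -> continuous f.
Proof. exact: continuous_comp_initial. Qed.

(** A cocone is glued by applying to each point the map of the least cell that
contains it. The result is continuous because its restrictions to the cells are,
and the cells form a finite closed cover. *)
Lemma strata_colimit (I : Type) (le : I -> I -> Prop) (F : diagram le)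
    (X : topologicalType) (inj : forall i, F i -> X) (code : X -> I)
    (J : finType) (K : I -> J) :
  (forall a, le a a) -> injective K -> is_cocone inj ->
  (forall i, injective (inj i)) ->
  (forall i B, closed B -> closed (inj i @` B)) ->
  (forall i x, range (inj i) x <-> le (code x) i) -> is_colimit inj.
Proof.
move=> refl injK coc injinj clinj codeP; split=> // Y f [cf ff].
have fib x : exists z, inj (code x) z = x.
  by have [z _ e] := (codeP (code x) x).2 (refl _); exists z.
pose lift x : F (code x) := sval (cid (fib x)).
have liftK x : inj _ (lift x) = x by exact: svalP (cid (fib x)).
have E i z : f (code (inj i z)) (lift (inj i z)) = f i z.
  have h : le (code (inj i z)) i by apply/codeP; exists z.
  rewrite -(ff _ _ h); congr (f i _); apply: (injinj i).
  by rewrite coc.2 liftK.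
exists (fun x => f (code x) (lift x)); split=> [|v [cv vf]].
  split=> //; apply: (continuous_closed_cover injK clinj) => [x|i].
    by exists (code x), (lift x).
  by rewrite (_ : _ \o _ = f i) //; apply/funext => z; exact: E.
by apply/funext => x; rewrite -vf liftK.
Qed.

(** * Continuous real functions *)

Section RealFunctions.
Variables (R : realType) (X : topologicalType) (f g : X -> R).
Hypotheses (cf : continuous f) (cg : continuous g).

Lemma continuous_add : continuous (fun x => f x + g x : R).
Proof. by move=> x; apply: cvgD; [exact: cf|exact: cg]. Qed.

Lemma continuous_sub : continuous (fun x => f x - g x : R).
Proof. by move=> x; apply: cvgB; [exact: cf|exact: cg]. Qed.

Lemma continuous_mul : continuous (fun x => f x * g x : R).
Proof. by move=> x; apply: cvgM; [exact: cf|exact: cg]. Qed.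

Lemma closed_fun_le : closed [set x | f x <= g x].
Proof.
rewrite (_ : [set x | _] = (fun x => f x - g x) @^-1` [set r | r <= 0]).
  apply: preimage_closed => [x _|]; last exact: closed_le.
  exact: continuous_sub.
by apply/seteqP; split=> x /=; rewrite subr_le0.
Qed.

End RealFunctions.

Section Minimum.
Variables (R : realType) (I : finType) (P : pred I) (d : R).

Lemma bigmin_continuous (X : topologicalType) (F : I -> X -> R) :
  (forall i, continuous (F i)) ->
  continuous (fun x => \big[Num.min/d]_(i | P i) F i x).
Proof.
move=> cF; elim: (index_enum I) => [|i r IH].
  under eq_fun do rewrite big_nil; exact: cst_continuous.
under eq_fun do rewrite big_cons.
case: (P i) => // x.
exact: (@continuous_min _ _ (F i) _ x (cF i x) (IH x)).
Qed.

Lemma bigmin_attained (F : I -> R) :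
  \big[Num.min/d]_(i | P i) F i = d \/
  exists2 i, P i & \big[Num.min/d]_(i | P i) F i = F i.
Proof.
elim/big_ind: _ => [|x y hx hy|i Pi]; [by left| |by right; exists i].
by rewrite minEle; case: ifP.
Qed.

End Minimum.

(** * Cofibrations from a push into a closed subspace *)

Section Push.
Variable R : realType.

Lemma clampIP (r : R) :
  Num.max 0 (Num.min 1 r) \in [set t : R | 0 <= t <= 1].
Proof.
by apply/mem_set; rewrite /= le_max lexx /= ge_max ler01 /= ge_min lexx.
Qed.

Definition clampI (r : R) : unitI R := SigSub (clampIP r).

Lemma clampI_continuous : continuous clampI.
Proof.
apply: continuous_comp_initial => x.
rewrite (_ : _ \o _ = (fun=> 0 : R^o) \max ((fun=> 1 : R^o) \min id)); last first.
  by apply/funext.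
apply: continuous_max; first exact: cvg_cst.
by apply: continuous_min; [exact: cvg_cst|exact: cvg_id].
Qed.

Lemma clampI_id (r : R) : 0 <= r <= 1 -> val (clampI r) = r.
Proof. by move=> /andP[r0 r1] /=; rewrite min_r // max_r. Qed.

Lemma unitI_range (t : unitI R) : 0 <= val t <= 1.
Proof. exact: set_mem (valP t). Qed.

Lemma clampI0 : clampI 0 = I0 R.
Proof. by apply: val_inj; rewrite clampI_id ?lexx ?ler01. Qed.

Lemma clampI_val (t : unitI R) : clampI (val t) = t.
Proof. by apply: val_inj; rewrite clampI_id // unitI_range. Qed.

(** The time [u x] measures how long the flow [h] takes to carry [x] into [A].
A homotopy [H] on [A] extends to the whole space by letting the point [x] flow
until it meets [A], and by running [H] during the remaining time. *)
Lemma push_closed_cofibration (X : topologicalType) (A : set X) (u : X -> R)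
    (h : X * unitI R -> X) :
  continuous u -> (forall x, 0 <= u x) -> (forall x, A x <-> u x = 0) ->
  continuous h -> (forall x, h (x, I0 R) = x) ->
  (forall x, u x <= 1 -> A (h (x, clampI (u x)))) ->
  closed_cofibration R (set_val : set_type A -> X).
Proof.
move=> cu u0 uA ch h0 hA.
have cA : closed A.
  have -> : A = u @^-1` [set r | r <= 0].
    apply/seteqP; split=> x /=; first by move/uA => ->.
    by move=> ux; apply/uA/eqP; rewrite eq_le ux u0.
  by apply: preimage_closed => [x _|]; [exact: cu|exact: closed_le].
split; last first.
  have := @set_val_closed_map _ A setT cA closedT.
  by [].
split; first exact: set_val_continuous.
move=> Y g H cg cH H0.
(* The last branch is never reached. *)
pose K (p : X * unitI R) : Y :=
  if val p.2 <= u p.1 then g (h p) else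
  if pselect (A (h (p.1, clampI (u p.1)))) is left Ax then
    H (SigSub (mem_set Ax), clampI (val p.2 - u p.1)) else g p.1.
have KE x t (Ax : A (h (x, clampI (u x)))) : u x <= val t ->
    K (x, t) = H (SigSub (mem_set Ax), clampI (val t - u x)).
  move=> ut; rewrite /K /=; case: ifPn => tu.
    have e : val t = u x by apply/eqP; rewrite eq_le tu ut.
    have -> : clampI (val t - u x) = I0 R by rewrite e subrr clampI0.
    by rewrite H0 set_valE /=; congr (g (h (_, _))); rewrite -e clampI_val.
  case: pselect => // Ax'; congr (H (_, _)); exact: val_inj.
exists K; split=> [|x|a t]; last first.
- have ua : u (set_val a) = 0 by apply/uA; exact: set_mem (valP a).
  have ha : h (set_val a, clampI (u (set_val a))) = set_val a.
    by rewrite ua clampI0 h0.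
  have Ax : A (h (set_val a, clampI (u (set_val a)))).
    by rewrite ha; exact: set_mem (valP a).
  rewrite KE; last by rewrite ua; case/andP: (unitI_range t).
  congr (H (_, _)); first exact: val_inj.
  by rewrite ua subr0 clampI_val.
- by rewrite /K /= u0 h0.
pose P : topologicalType := (X * unitI R)%type.
have cvt : continuous (fun p : P => val p.2 : R).
  by apply: continuous_fun_comp (@set_val_continuous _ _) => p; exact: cvg_snd.
have cu1 : continuous (fun p : P => u p.1).
  by apply: continuous_fun_comp cu => p; exact: cvg_fst.
have cd := continuous_sub cvt cu1.
pose D (b : bool) : set P :=
  if b then [set p | val p.2 <= u p.1] else [set p | u p.1 <= val p.2].
have cD b : closed (D b) by case: b; exact: closed_fun_le.
apply: (@continuous_closed_cover P Y bool bool id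
  (fun b => set_type (D b)) (fun b => set_val)) => [|b B cB|p|[]].
- by [].
- exact: set_val_closed_map.
- have [tu|ut] := leP (val p.2) (u p.1).
    by exists true, (SigSub (mem_set (tu : D true p))).
  by exists false, (SigSub (mem_set (ltW ut : D false p))).
- have -> : K \o set_val = (g \o h) \o (set_val : set_type (D true) -> P).
    apply/funext => z /=; have := set_mem (valP z); rewrite /K /D /= => zu.
    by rewrite set_valE zu.
  apply: continuous_fun_comp (@set_val_continuous _ _) _.
  exact: continuous_fun_comp ch cg.
- have Dz (z : set_type (D false)) : u (set_val z).1 <= val (set_val z).2.
    exact: set_mem (valP z).
  have Az (z : set_type (D false)) :
      A (h ((set_val z).1, clampI (u (set_val z).1))).
    by apply: hA; apply: le_trans (Dz z) _; case/andP: (unitI_range (set_val z).2).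
  have -> : K \o set_val = H \o (fun z : set_type (D false) =>
      (SigSub (mem_set (Az z)) : set_type A,
       clampI (val (set_val z).2 - u (set_val z).1))).
    by apply/funext => z /=; rewrite -(KE _ _ (Az z) (Dz z)) -surjective_pairing.
  have cz := @set_val_continuous _ (D false).
  have cuz := continuous_fun_comp cz cu1.
  apply: continuous_fun_comp cH; apply: continuous_pair; last first.
    exact: continuous_fun_comp (continuous_fun_comp cz cd) clampI_continuous.
  apply: continuous_to_set_type; apply: continuous_fun_comp ch.
  apply: continuous_pair; last exact: continuous_fun_comp cuz clampI_continuous.
  by apply: continuous_fun_comp cz _ => p; exact: cvg_fst.
Qed.

End Push.

(** * The graph of a configuration *)

Lemma irreflexive_no_cycle (T : eqType) (e : rel T) (p : seq T) :
  irreflexive e -> transitive e -> p != [::] -> ~~ path.cycle e p.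
Proof.
move=> irr tr; case: p => // x p _; apply/negP => /= /(order_path_min tr).
by rewrite all_rcons irr.
Qed.

Section Separation.
Variables (R : realType) (m : nat).

Definition lo n (C : config R m n) (i : 'I_n) (v : 'I_m) : R :=
  (cube_at C i).1 0 v.

Definition hi n (C : config R m n) (i : 'I_n) (v : 'I_m) : R :=
  (cube_at C i).2 0 v.

Definition nondegenerate n (C : config R m n) : Prop :=
  forall i v, lo C i v < hi C i v.

Definition separated n (C : config R m n) : Prop :=
  forall i j, i != j -> exists v, (hi C i v <= lo C j v) || (hi C j v <= lo C i v).

(** Two boxes have a common interior point exactly when their projections to
each coordinate axis do. *)
Lemma little_cubesP n (C : config R m n) :
  little_cubes C <->
  [/\ nondegenerate C, forall i v, -1 <= lo C i v /\ hi C i v <= 1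
    & separated C].
Proof.
split=> [[B P]|[nd B S]]; last first.
  split=> [i v|i j ij].
    by have [b1 b2] := B i v; split => //; exact: nd.
  have [v] := S i j ij; rewrite /lo /hi => sv.
  rewrite -subset0 => x [/(_ v)/andP[h1 h2] /(_ v)/andP[h3 h4]] /=.
  by case/orP: sv => h; lra.
split=> [i v|i v|i j ij]; first by have [] := B i v.
  by have [] := B i v.
apply: contrapT => /forallNP no.
have {}no v : lo C j v < hi C i v /\ lo C i v < hi C j v.
  by have /negP := no v; rewrite negb_or -!ltNge => /andP.
have : (box_interior (cube_at C i) `&` box_interior (cube_at C j))
    (\row_v ((Num.max (lo C i v) (lo C j v) + Num.min (hi C i v) (hi C j v)) / 2)).
  have lt i' v : lo C i' v < hi C i' v by have [] := B i' v.
  split=> v; rewrite mxE -/(lo C _ v) -/(hi C _ v); move: (no v) (lt i v) (lt j v).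
    case: (leP (lo C i v) (lo C j v)); case: (leP (hi C i v) (hi C j v));
      by move=> ? ? [? ?] ? ?; apply/andP; split; lra.
  case: (leP (lo C i v) (lo C j v)); case: (leP (hi C i v) (hi C j v));
    by move=> ? ? [? ?] ? ?; apply/andP; split; lra.
by rewrite P.
Qed.

Variable prime : bool.

(** In the last direction an open box can only lie below a closed one. The
largest number [m] is allowed between them on arrows from open to closed in RK',
so that there arrows have to point upwards, and on arrows from closed to open in
RK, where they have to point downwards. *)
Definition precedes n (C : config R m n) (v : 'I_m) i j : bool :=
  if prime then hi C i v <= lo C j v else hi C j v <= lo C i v.

(** Directions are numbered from 1, like the edges of the graphs. *)
Definition before n (C : config R m n) (k : nat) i j : bool :=
  [exists v : 'I_m, (v.+1 == k) && precedes C v i j].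

Definition apart n (C : config R m n) k i j : bool :=
  before C k i j || before C k j i.

Definition least_direction n (C : config R m n) i j : nat :=
  (find (fun k => apart C k i j) (iota 1 m)).+1.

Definition config_graph n (C : config R m n) : graph n :=
  [ffun e => if e.1 == e.2 then (0%N, false)
    else (least_direction C e.1 e.2,
          before C (least_direction C e.1 e.2) e.1 e.2)].

Section OneConfig.
Variables (n : nat) (C : config R m n).

Lemma beforeP k i j :
  reflect (exists2 v : 'I_m, v.+1 = k & precedes C v i j) (before C k i j).
Proof.
apply: (iffP existsP) => [[v /andP[/eqP e h]]|[v e h]]; exists v => //.
by rewrite e eqxx.
Qed.

Lemma apartC k i j : apart C k i j = apart C k j i.
Proof. exact: orbC. Qed.

Lemma least_directionC i j : least_direction C i j = least_direction C j i.
Proof. by congr _.+1; apply: eq_find => k; exact: apartC. Qed.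

Lemma apart_range k i j : apart C k i j -> (0 < k <= m)%N.
Proof.
by case/orP=> /beforeP[v <- _]; rewrite ltn_ord.
Qed.

Lemma least_direction_min k i j :
  apart C k i j -> (least_direction C i j <= k)%N.
Proof.
move=> ak; have /andP[k0 km] := apart_range ak; rewrite leqNgt ltnS.
apply/negP; rewrite -(prednK k0) => lt; have := before_find 0%N lt.
by rewrite nth_iota ?add1n prednK ?ak //; lia.
Qed.

Hypothesis nd : nondegenerate C.

Lemma precedes_lt v i j : precedes C v i j ->
  if prime then lo C i v < lo C j v else lo C j v < lo C i v.
Proof. by rewrite /precedes; case: prime => h; exact: lt_le_trans (nd _ v) h. Qed.

Lemma before_asym k i j : before C k i j -> before C k j i -> False.
Proof.
case/beforeP=> v <- /precedes_lt h1 /beforeP[w [/val_inj ->]] /precedes_lt.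
by move: h1; case: prime => h1 /(lt_trans h1); rewrite ltxx.
Qed.

Hypothesis sepC : separated C.

Lemma apart_least i j : i != j -> apart C (least_direction C i j) i j.
Proof.
move=> ij; have [v sv] := sepC ij.
have av : apart C v.+1 i j.
  by move: sv; rewrite /apart; case/orP=> h; apply/orP;
    case E : prime; [left|right|right|left]; apply/beforeP; exists v => //;
    rewrite /precedes E.
have hv : has (fun k => apart C k i j) (iota 1 m).
  by apply/hasP; exists v.+1 => //; rewrite mem_iota; have := ltn_ord v; lia.
have := nth_find 0%N hv.
by rewrite nth_iota ?add1n // -[X in (_ < X)%N](size_iota 1) -has_find.
Qed.

Lemma config_graph_edges : edge_axiom (config_graph C).
Proof.
split=> [i|i j ij]; first by rewrite ffunE eqxx.
rewrite /edge_num /edge_arr !ffunE /= [j == i]eq_sym (negPf ij) /=.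
rewrite [least_direction C j i]least_directionC; split=> //.
case/orP: (apart_least ij) => b; rewrite b; last first.
  by apply/esym/negP => b'; exact: before_asym b' b.
by apply/negbTE/negP => b'; exact: before_asym b' b.
Qed.

Lemma config_graph_arr i j : edge_arr (config_graph C) i j =
  (i != j) && before C (least_direction C i j) i j.
Proof. by rewrite /edge_arr ffunE /=; case: eqVneq. Qed.

Lemma config_graph_num i j : i != j ->
  edge_num (config_graph C) i j = least_direction C i j.
Proof. by rewrite /edge_num ffunE /= => /negPf ->. Qed.

Lemma config_graph_before i j : edge_arr (config_graph C) i j ->
  before C (edge_num (config_graph C) i j) i j.
Proof.
rewrite config_graph_arr => /andP[ij]; by rewrite config_graph_num.
Qed.

(** The arrows of a given number order the boxes strictly by their positions
along one axis. *)
Lemma config_graph_acyclic : acyclic (config_graph C).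
Proof.
move=> k p p0; have [[v vk]|nv] := pselect (exists v : 'I_m, v.+1 = k); last first.
  case: p p0 => // x p _; apply/negP => hp; apply: nv.
  have : exists y, edge_arr (config_graph C) x y && (edge_num (config_graph C) x y == k).
    by move: hp; case: p => [|y p] /= /andP[h _]; [exists x|exists y].
  case=> y /andP[/config_graph_before h /eqP e].
  by move: h; rewrite e => /beforeP[v]; exists v.
have := @irreflexive_no_cycle _
  (fun i j => if prime then lo C i v < lo C j v else lo C j v < lo C i v) p.
move=> H; have {}H := H _ _ p0; apply: contraNN (H _ _).
- apply: sub_cycle => i j /andP[/config_graph_before + /eqP e].
  rewrite e => /beforeP[w wk /precedes_lt].
  by have -> : w = v by apply: val_inj; apply: succn_inj; rewrite wk vk.
- by move=> i; case: prime; rewrite ltxx.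
- by move=> i j l; case: prime => h1 h2;
    [exact: lt_trans h1 h2|exact: lt_trans h2 h1].
Qed.

Definition fits (a : graph n) i j : bool :=
  before C (edge_num a i j) i j ||
  [exists k : 'I_(edge_num a i j), apart C k i j].

(** The graph of a configuration records the least separating directions, so it
lies below [a] as soon as every arrow of [a] is explained by some separation,
whether or not that one is the least. *)
Lemma config_graph_leP (a : graph n) : edge_axiom a ->
  graph_le (config_graph C) a <-> (forall i j, edge_arr a i j -> fits a i j).
Proof.
move=> ea; have [_ E] := ea.
have G := config_graph_edges; have [_ EG] := G.
split=> [H i j aij|H i j ij].
  have ij := edge_irr ea aij; rewrite /fits.
  case: (H i j ij) => [e|lt].
    have aCij : edge_arr (config_graph C) i j by rewrite /edge_arr e.
    by have := config_graph_before aCij; rewrite /edge_num e => ->.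
  move: lt; rewrite config_graph_num // => lt; apply/orP; right.
  by apply/existsP; exists (Ordinal lt); exact: apart_least.
have key i' j' : i' != j' -> edge_arr a i' j' ->
    config_graph C (i', j') = a (i', j') \/
    (edge_num (config_graph C) i' j' < edge_num a i' j')%N.
  move=> ij' aij; rewrite config_graph_num //.
  case/orP: (H i' j' aij) => [b|/existsP[k ak]]; last first.
    by right; apply: leq_ltn_trans (least_direction_min ak) _; exact: ltn_ord.
  have ak : apart C (edge_num a i' j') i' j' by rewrite /apart b.
  have := least_direction_min ak; rewrite leq_eqVlt => /orP[/eqP e|]; last by right.
  left; rewrite ffunE /= (negPf ij') e b.
  by rewrite -aij /edge_arr /edge_num -surjective_pairing.
have [_ na aa] := E i j ij; have [_ nC aC] := EG i j ij.
have [aij|aij] := boolP (edge_arr a i j); first exact: key.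
have aji : edge_arr a j i by rewrite aa aij.
case: (key j i _ aji); [by rewrite eq_sym| |by rewrite na nC; right].
move=> e; left; rewrite [LHS]surjective_pairing [RHS]surjective_pairing.
congr pair; first by move: nC na; rewrite /edge_num e => <- <-.
move: aC aa; rewrite /edge_arr e => -> /eqP; rewrite eqb_negLR negbK.
by move=> /eqP.
Qed.

End OneConfig.

(** In the last direction an open box is symmetric about the hyperplane above
which the closed boxes lie, so no box can be entirely below it. *)
Lemma good_last_direction n (c : 'I_n -> colour) (C : config R m n) (v : 'I_m) i j :
  good c C -> v.+1 = m -> c j = op -> ~~ (hi C i v <= lo C j v).
Proof.
move=> [/little_cubesP[nd _ _] Ccl Cop] vm cj; rewrite -ltNge.
have hj : lo C j v = - hi C j v by exact: Cop.
have := nd j v; have := nd i v; rewrite hj => h1 h2.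
case ci : (c i); first by have := Ccl i ci v vm; rewrite -/(lo C i v) => h3; lra.
have : lo C i v = - hi C i v by exact: Cop.
by move=> e; rewrite e in h1; lra.
Qed.

Lemma SC_set_little (q : upper_cube R m) n (c : 'I_n -> colour) c0
    (C : config R m n) : SC_set q c c0 C -> little_cubes C.
Proof. by case: c0 => [[]//|/SC_op_good[]]. Qed.

Lemma config_graph_RK (q : upper_cube R m) n (c : 'I_n -> colour) c0
    (C : config R m n) :
  SC_set q c c0 C -> RK_set prime m c c0 (config_graph C).
Proof.
move=> HC; have LC := SC_set_little HC.
have [nd B S] := (little_cubesP C).1 LC.
split.
- by move=> e; move: HC; rewrite e => -[].
- exact: config_graph_edges.
- exact: config_graph_acyclic.
move=> i j aij; have := config_graph_before aij.
case/beforeP=> v <- vij.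
have le : (v.+1 <= m)%N by exact: ltn_ord.
case: c0 HC => // /SC_op_good G.
have K i' j' : c j' = op -> hi C i' v <= lo C j' v -> (v.+1 <= m.-1)%N.
  move=> cj h; have : v.+1 != m.
    by apply: contraTneq h => vm; exact: good_last_direction G vm cj.
  by lia.
move: vij; rewrite /precedes /RK_bound.
by case ci : (c i); case cj : (c j) => //; case: prime => // h;
  solve [exact: (K _ _ ci h)|exact: (K _ _ cj h)].
Qed.

End Separation.

(** * Configurations in coordinates *)

(** This component is a single point, named by a cube that may fill the standard
cube: it is not described by the inequalities that define the other components
with open output, and moves are constant on it. *)
Definition one_point n (c0 : colour) : bool := if c0 is op then n == 1%N else false.

Section Coordinates.
Variables (R : realType) (m : nat).

(** For a fixed output colour the components are cut out, inside the separated
configurations, by these conditions on the projections of single boxes; they are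
convex and stable under shrinking. [last] refers to the axis of the
reflection. *)
Definition interval_ok (c0 ci : colour) (last : bool) (x y : R) : Prop :=
  match c0 with
  | cl => [/\ -1 <= x, x < y & y <= 1]
  | op => [/\ -1 < x, x < y, y < 1 & last -> if ci is cl return Prop then 0 < x else x = - y]
  end.

Lemma interval_ok_lt c0 ci last x y : interval_ok c0 ci last x y -> x < y.
Proof. by case: c0 => -[]. Qed.

Lemma convex_gt0 (s p p' : R) : 0 <= s <= 1 -> 0 < p -> 0 < p' ->
  0 < p + s * (p' - p).
Proof.
move=> /andP[s0 s1] p0 p0'; have [->|s_neq0] := eqVneq s 0.
  by rewrite mul0r addr0.
have sp : 0 < s * p' by rewrite mulr_gt0 // lt_def s_neq0.
have tp : 0 <= (1 - s) * p by rewrite mulr_ge0 ?subr_ge0 // ltW.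
by lra.
Qed.

Lemma convex_ge0 (s p p' : R) : 0 <= s <= 1 -> 0 <= p -> 0 <= p' ->
  0 <= p + s * (p' - p).
Proof.
move=> /andP[s0 s1] p0 p0'.
have sp : 0 <= s * p' by rewrite mulr_ge0.
have tp : 0 <= (1 - s) * p by rewrite mulr_ge0 ?subr_ge0.
by lra.
Qed.

Lemma interval_ok_convex c0 ci last s x y x' y' : 0 <= s <= 1 ->
  interval_ok c0 ci last x y -> interval_ok c0 ci last x' y' ->
  interval_ok c0 ci last (x + s * (x' - x)) (y + s * (y' - y)).
Proof.
move=> s01; have C0 := @convex_gt0 s _ _ s01; have C1 := @convex_ge0 s _ _ s01.
case: c0 => /= [[h1 h2 h3] [h4 h5 h6]|[h1 h2 h3 h] [h4 h5 h6 h']].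
  have := C1 (x + 1) (x' + 1); have := C0 (y - x) (y' - x').
  by have := C1 (1 - y) (1 - y') => k1 k2 k3; split; lra.
have := C0 (x + 1) (x' + 1); have := C0 (y - x) (y' - x').
have := C0 (1 - y) (1 - y') => k1 k2 k3; split; [lra|lra|lra|move=> l].
move: (h l) (h' l).
by case: ci {h h'} => h h'; [exact: C0|rewrite h h'; ring].
Qed.

Lemma interval_ok_shrink c0 ci last s x y : 0 <= s <= 1 ->
  interval_ok c0 ci last x y ->
  interval_ok c0 ci last (x + s / 4 * (y - x)) (y - s / 4 * (y - x)).
Proof.
move=> /andP[s0 s1]; case: c0 => /= [[h1 h2 h3]|[h1 h2 h3 h]].
  by split; nra.
split; [nra|nra|nra|move=> l; move: (h l)].
by case: ci {h} => h; [nra|rewrite h; ring].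
Qed.

Definition make_config n (f g : 'I_n -> 'I_m -> R) : config R m n :=
  \row_i ((\row_v f i v, \row_v g i v) : 'rV[R]_m * 'rV[R]_m).

Lemma lo_make n (f g : 'I_n -> 'I_m -> R) i v : lo (make_config f g) i v = f i v.
Proof. by rewrite /lo /cube_at !mxE. Qed.

Lemma hi_make n (f g : 'I_n -> 'I_m -> R) i v : hi (make_config f g) i v = g i v.
Proof. by rewrite /hi /cube_at !mxE. Qed.

Lemma config_eq n (C C' : config R m n) : (forall i v, lo C i v = lo C' i v) ->
  (forall i v, hi C i v = hi C' i v) -> C = C'.
Proof.
move=> hl hh; apply/rowP => i; rewrite [LHS]surjective_pairing.
rewrite [RHS]surjective_pairing; congr pair; apply/rowP => v.
  exact: hl.
exact: hh.
Qed.

Lemma lo_continuous n (i : 'I_n) (v : 'I_m) :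
  continuous (fun C : config R m n => lo C i v).
Proof.
have cu : continuous (fun C : config R m n => cube_at C i) by exact: continuous_entry.
have c1 : continuous (fun b : cube R m => b.1) by move=> b; exact: cvg_fst.
have ce : continuous (fun r : 'rV[R]_m => r 0 v) by exact: continuous_entry.
exact: continuous_fun_comp (continuous_fun_comp cu c1) ce.
Qed.

Lemma hi_continuous n (i : 'I_n) (v : 'I_m) :
  continuous (fun C : config R m n => hi C i v).
Proof.
have cu : continuous (fun C : config R m n => cube_at C i) by exact: continuous_entry.
have c2 : continuous (fun b : cube R m => b.2) by move=> b; exact: cvg_snd.
have ce : continuous (fun r : 'rV[R]_m => r 0 v) by exact: continuous_entry.
exact: continuous_fun_comp (continuous_fun_comp cu c2) ce.
Qed.

Lemma make_config_continuous (Z : topologicalType) n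
    (f g : Z -> 'I_n -> 'I_m -> R) :
  (forall i v, continuous (fun z => f z i v)) ->
  (forall i v, continuous (fun z => g z i v)) ->
  continuous (fun z => make_config (f z) (g z)).
Proof.
have cr (h : Z -> 'I_n -> 'I_m -> R) i : (forall v, continuous (fun z => h z i v)) ->
    continuous (fun z => \row_v h z i v : 'rV[R]_m).
  move=> ch; apply: continuous_row => v.
  rewrite (_ : (fun z => _) = (fun z => h z i v)); first exact: ch.
  by apply/funext => z; rewrite mxE.
move=> cf cg; apply: continuous_row => i.
rewrite (_ : (fun z => _) = fun z => (\row_v f z i v, \row_v g z i v)); last first.
  by apply/funext => z; rewrite mxE.
by apply: continuous_pair; exact: cr.
Qed.

Lemma SC_setP (q : upper_cube R m) n (c : 'I_n -> colour) c0 (C : config R m n) :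
  ~ nullary_open n c0 -> ~~ one_point n c0 ->
  SC_set q c c0 C <-> [/\ c0 = cl -> forall i, c i = cl,
    forall i (v : 'I_m), interval_ok c0 (c i) (v.+1 == m) (lo C i v) (hi C i v)
    & separated C].
Proof.
case: c0 => [_ _|n0 n1].
  split=> [[h /little_cubesP[nd B S]]|[h ok S]].
    by split=> // i v; have [] := B i v.
  split; first exact: h.
  apply/little_cubesP; split=> // i v; first exact: interval_ok_lt (ok i v).
  by have [] := ok i v.
have n0' : n != 0%N by apply/eqP => n0'; apply: n0.
have n2 : (1 < n)%N by move: n0' n1 => /=; case: (n) => [|[]].
have -> : SC_set q c op C = symmetric_configs c C.
  by rewrite /SC_set (negPf n0') ifN.
split=> [SC|[_ ok S]].
  have [/little_cubesP[nd B S] Gcl Gop] := symmetric_good SC.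
  case: SC => H _ _ _; split=> // i v.
  have [h1 h2 h3] := H i v; split => // /eqP vm.
  by case ci : (c i); [exact: Gcl|exact: Gop].
apply: good_symmetric => //; first by move=> i v; have [] := ok i v.
split.
- apply/little_cubesP; split=> // i v; first exact: interval_ok_lt (ok i v).
  by have [h1 _ h2 _] := ok i v; rewrite !ltW.
- by move=> i ci v /eqP vm; have [_ _ _ /(_ vm)] := ok i v; rewrite ci.
- by move=> i ci v /eqP vm; have [_ _ _ /(_ vm)] := ok i v; rewrite ci.
Qed.

(** Any two vertices are joined by an arrow, so explaining the arrows of one
graph is enough to separate all the boxes. *)
Lemma fits_separated prime n (C : config R m n) (a : graph n) : edge_axiom a ->
  (forall i j, edge_arr a i j -> fits prime C a i j) -> separated C.
Proof.
move=> [_ E] H.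
have key i j : edge_arr a i j ->
    exists v : 'I_m, (hi C i v <= lo C j v) || (hi C j v <= lo C i v).
  have b k i' j' : before prime C k i' j' -> exists v : 'I_m,
      (hi C i' v <= lo C j' v) || (hi C j' v <= lo C i' v).
    case/beforeP=> v _ h; exists v; move: h; rewrite /precedes.
    by case: prime {H} => ->; rewrite ?orbT.
  move=> /H/orP[/b //|/existsP[k /orP[/b //|/b[v h]]]].
  by exists v; rewrite orbC.
move=> i j ij; have [_ _ e] := E i j ij.
have [/key //|nij] := boolP (edge_arr a i j).
by have /key[v h] : edge_arr a j i by [rewrite e nij]; exists v; rewrite orbC.
Qed.

Lemma precedes_eq prime n (C C' : config R m n) v i j :
  (forall k, lo C' k v = lo C k v) -> (forall k, hi C' k v = hi C k v) ->
  precedes prime C' v i j = precedes prime C v i j.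
Proof. by move=> hl hh; rewrite /precedes !hl !hh. Qed.

Lemma precedes_convex prime s n (C D C' : config R m n) v i j : 0 <= s <= 1 ->
  (forall k, lo C' k v = lo C k v + s * (lo D k v - lo C k v)) ->
  (forall k, hi C' k v = hi C k v + s * (hi D k v - hi C k v)) ->
  precedes prime C v i j -> precedes prime D v i j -> precedes prime C' v i j.
Proof.
move=> s01 hl hh; rewrite /precedes !hl !hh.
case: prime => h h'; rewrite -subr_ge0.
  have := @convex_ge0 s (lo C j v - hi C i v) (lo D j v - hi D i v) s01.
  by rewrite !subr_ge0 => /(_ h h'); lra.
have := @convex_ge0 s (lo C i v - hi C j v) (lo D i v - hi D j v) s01.
by rewrite !subr_ge0 => /(_ h h'); lra.
Qed.

Lemma fits_mono prime n n' (C : config R m n) (C' : config R m n')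
    (a : graph n) (a' : graph n') i j i' j' :
  edge_num a' i' j' = edge_num a i j ->
  (forall v, precedes prime C v i j -> precedes prime C' v i' j') ->
  (forall v, precedes prime C v j i -> precedes prime C' v j' i') ->
  fits prime C a i j -> fits prime C' a' i' j'.
Proof.
move=> e h1 h2; rewrite /fits e.
have b1 k : before prime C k i j -> before prime C' k i' j'.
  by case/beforeP=> v ev h; apply/beforeP; exists v => //; exact: h1.
have b2 k : before prime C k j i -> before prime C' k j' i'.
  by case/beforeP=> v ev h; apply/beforeP; exists v => //; exact: h2.
case/orP=> [/b1 ->//|/existsP[k h]]; apply/orP; right; apply/existsP; exists k.
by apply/orP; case/orP: h => [/b1|/b2]; [left|right].
Qed.

End Coordinates.

(** * A configuration in every cell *)

Section Rank.
Variables (T : finType) (e : rel T).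

Definition ancestors (x : T) : nat := #|[pred y | connect e y x]|.

Lemma ancestors_gt0 x : (0 < ancestors x)%N.
Proof. by apply/card_gt0P; exists x; rewrite inE connect0. Qed.

(** Counting ancestors turns an acyclic relation into heights. *)
Lemma ancestors_lt : (forall p : seq T, p != [::] -> ~~ path.cycle e p) ->
  forall x y, e x y -> (ancestors x < ancestors y)%N.
Proof.
move=> nocycle x y exy; apply: proper_card; apply/properP; split.
  apply/fintype.subsetP => z; rewrite !inE => zx.
  exact: connect_trans zx (connect1 exy).
exists y; rewrite !inE ?connect0 //; apply/negP => /connectP[p hp lp].
have := nocycle (y :: p) isT.
by rewrite /= rcons_path hp -lp exy.
Qed.

End Rank.

Lemma RK_num_le prime m n (c : 'I_n -> colour) c0 (a : graph n) i j :
  RK_set prime m c c0 a -> (edge_num a i j <= m)%N.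
Proof.
move=> [_ [D E] _ bd].
have b k l : edge_arr a k l -> (edge_num a k l <= m)%N.
  move=> akl; apply: leq_trans (bd _ _ akl) _; rewrite /RK_bound.
  by case: (c0) => //; case: (c k) => //; case: (c l) => //; case: (prime);
    rewrite ?leq_pred.
have [<-|ij] := eqVneq i j; first by rewrite /edge_num D.
have [_ e e'] := E i j ij; have [/b //|nij] := boolP (edge_arr a i j).
by rewrite -e; apply: b; rewrite e'.
Qed.

Section Target.
Variables (R : realType) (m : nat) (hm : (0 < m)%N) (prime : bool).
Variables (n : nat) (c : 'I_n -> colour) (c0 : colour) (a : graph n).
Hypothesis Ha : RK_set prime m c c0 a.

Definition must_lie_below (v : 'I_m) : rel 'I_n := fun i j =>
  (edge_num a i j == v.+1) && (if prime then edge_arr a i j else edge_arr a j i).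

Lemma must_lie_below_no_cycle v (p : seq 'I_n) :
  p != [::] -> ~~ path.cycle (must_lie_below v) p.
Proof.
have [_ ea ac _] := Ha; move=> p0; rewrite /must_lie_below; case: (prime).
  apply: contraNN (ac v.+1 p p0); apply: sub_cycle => i j /andP[h1 h2].
  by rewrite h2 h1.
(* In RK the arrows point downwards, so a cycle of boxes below each other has to be
   reversed to become a cycle of arrows. *)
have rp0 : rev p != [::] by rewrite -size_eq0 size_rev size_eq0.
apply: contraNN (ac v.+1 (rev p) rp0); rewrite rev_cycle.
apply: sub_cycle => i j /andP[h1 h2]; rewrite h2 /=.
by have [_ <- _] := ea.2 _ _ (edge_irr ea h2).
Qed.

(** This is where the bounds on the numbers of the edges at open vertices are
used: they forbid the edges that no configuration can realise. *)
Lemma must_lie_below_closed v i j :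
  must_lie_below v i j -> v.+1 = m -> c0 = op -> c j = cl.
Proof.
have [_ ea _ bd] := Ha; move=> /andP[/eqP e b] vm e0; case cj : (c j) => //.
move: b bd; rewrite e0; case: (prime) => b bd; have := bd _ _ b.
  by rewrite e vm cj /=; case: (c i) => /=; lia.
have [_ e' _] := ea.2 _ _ (edge_irr ea b); rewrite -e' e vm cj /=.
by case: (c i) => /=; lia.
Qed.

(** The number of ancestors is between 1 and [n], so the intervals lie inside the
open unit interval, and those of different heights are disjoint. *)
Definition target_hi i (v : 'I_m) : R :=
  (2 * ancestors (must_lie_below v) i + 1)%:R / (2 * n + 2)%:R.

Definition mirrored i (v : 'I_m) : bool :=
  (if c0 is op then if c i is op then true else false else false) && (v.+1 == m).

Definition target_lo i (v : 'I_m) : R :=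
  if mirrored i v then - target_hi i v
  else (2 * ancestors (must_lie_below v) i)%:R / (2 * n + 2)%:R.

(** Along each axis the boxes are stacked in the order that the arrows of that
direction generate, at heights between 0 and 1; in the last direction the open
boxes reach down to their mirror images. *)
Definition target : config R m n := make_config target_lo target_hi.

Lemma target_ok i (v : 'I_m) :
  interval_ok c0 (c i) (v.+1 == m) (target_lo i v) (target_hi i v).
Proof.
rewrite /target_lo /target_hi; set r := ancestors _ i.
have r0 : (0 < r)%N by exact: ancestors_gt0.
have rn : (r <= n)%N by rewrite -[X in (_ <= X)%N]card_ord; exact: max_card.
have N0 : 0 < (2 * n + 2)%:R :> R by rewrite ltr0n; lia.
have h1 : 0 < (2 * r)%:R / (2 * n + 2)%:R :> R.
  by rewrite divr_gt0 // ltr0n; lia.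
have h2 : (2 * r)%:R / (2 * n + 2)%:R < (2 * r + 1)%:R / (2 * n + 2)%:R :> R.
  by rewrite ltr_pM2r ?invr_gt0 // ltr_nat; lia.
have h3 : (2 * r + 1)%:R / (2 * n + 2)%:R < 1 :> R.
  by rewrite ltr_pdivrMr // mul1r ltr_nat; lia.
rewrite /mirrored /interval_ok; case: c0 => /=; first by split; lra.
case: (c i) => /=; first by split => //; lra.
case: ifP => // _; first by split => //; lra.
by split => //; lra.
Qed.

Lemma target_fits i j : edge_arr a i j -> before prime target (edge_num a i j) i j.
Proof.
have [_ ea _ bd] := Ha; move=> aij; have num_le := RK_num_le i j Ha.
have [num_gt0 numC _] := ea.2 _ _ (edge_irr ea aij).
have lt : ((edge_num a i j).-1 < m)%N by lia.
pose v := Ordinal lt; have ev : v.+1 = edge_num a i j by rewrite /= prednK.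
have stack k l : must_lie_below v k l -> hi target k v <= lo target l v.
  move=> b; rewrite hi_make lo_make /target_lo ifN; last first.
    rewrite /mirrored; apply/negP => /andP[+ /eqP vm].
    have := must_lie_below_closed b vm; case: (c0) => // /(_ erefl).
    by case: (c l).
  rewrite ler_pM2r ?invr_gt0 ?ltr0n; last by lia.
  rewrite ler_nat; have := ancestors_lt (@must_lie_below_no_cycle v) b; lia.
apply/beforeP; exists v => //; rewrite /precedes.
case E : prime; apply: stack; rewrite /must_lie_below E; first by rewrite ev eqxx.
by rewrite numC ev eqxx.
Qed.

End Target.

(** * The cells *)

Section ClosedConditions.
Variables (R : realType) (m n : nat) (prime : bool).

Lemma closed_before k i j :
  closed [set C : config R m n | before prime C k i j].
Proof.
rewrite (_ : [set C | _] = [set C : config R m n |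
    exists v : 'I_m, v.+1 = k /\ precedes prime C v i j]); last first.
  by apply/seteqP; split=> C /=; [move/beforeP=> [v e h]; exists v|
    case=> v [e h]; apply/beforeP; exists v].
apply: (@closed_union_fin _ _ _ id) => // v.
have [e|ne] := eqVneq v.+1 k; last first.
  rewrite (_ : (fun C => _) = set0); first exact: closed0.
  by apply/seteqP; split=> // C [e _]; rewrite e eqxx in ne.
rewrite (_ : (fun C => _) = [set C : config R m n | precedes prime C v i j]).
  rewrite /precedes; case: (prime); apply: closed_fun_le;
    by [exact: hi_continuous|exact: lo_continuous].
by apply/seteqP; split=> C; [case|split].
Qed.

Lemma closed_fits (a : graph n) i j :
  closed [set C : config R m n | fits prime C a i j].
Proof.
rewrite (_ : [set C | _] = [set C : config R m n |
      before prime C (edge_num a i j) i j] `|`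
    [set C | exists k : 'I_(edge_num a i j),
      ([set C | before prime C k i j] `|` [set C | before prime C k j i]) C]).
  apply: closedU; first exact: closed_before.
  apply: (@closed_union_fin _ _ _ id) => // k.
  by apply: closedU; exact: closed_before.
apply/seteqP; split=> C; rewrite /fits /=.
  case/orP=> [|/existsP[k /orP h]]; [by left|right; exists k].
  by case: h; [left|right].
case=> [->//|[k h]]; apply/orP; right; apply/existsP; exists k.
by apply/orP; case: h; [left|right].
Qed.

End ClosedConditions.

Section Encoding.
Variables (prime : bool) (m n : nat) (c : 'I_n -> colour) (c0 : colour).

Definition RK_encode (a : RK_cell prime m c c0) :
    {ffun 'I_n * 'I_n -> 'I_m.+1 * bool} :=
  [ffun e => (inord (val a e).1, (val a e).2)].

Lemma RK_encode_inj : injective RK_encode.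
Proof.
move=> a b /ffunP e; apply: val_inj; apply/ffunP => -[i j].
have := e (i, j); rewrite !ffunE => -[/(congr1 (@nat_of_ord _)) h1 h2].
have Ha := RK_num_le i j (set_mem (valP a)).
have Hb := RK_num_le i j (set_mem (valP b)).
rewrite !inordK // in h1.
by rewrite [LHS]surjective_pairing [RHS]surjective_pairing h1 h2.
Qed.

End Encoding.

Section Cells.
Variables (R : realType) (m : nat) (q : upper_cube R m) (prime : bool).
Variables (n : nat) (c : 'I_n -> colour) (c0 : colour).

Notation S := (SC_space q c c0).
Notation A := (RK_cell prime m c c0).

Lemma cell_index_proof (x : S) :
  config_graph prime (set_val x) \in RK_set prime m c c0.
Proof. by apply/mem_set/config_graph_RK; exact: set_mem (valP x). Qed.

Definition cell_index (x : S) : A := SigSub (cell_index_proof x).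

Definition cell_set (a : A) : set S := [set x | RK_le (cell_index x) a].

Lemma cell_map_proof (a b : A) (h : RK_le a b) (x : set_type (cell_set a)) :
  set_val x \in cell_set b.
Proof. by apply/mem_set; exact: RK_le_trans (set_mem (valP x)) h. Qed.

Definition cell_map (a b : A) (h : RK_le a b) (x : set_type (cell_set a)) :
  set_type (cell_set b) := SigSub (cell_map_proof h x).

Lemma cell_map_continuous (a b : A) (h : RK_le a b) : continuous (cell_map h).
Proof. by apply: continuous_to_set_type; exact: set_val_continuous. Qed.

Lemma cell_map_id (a : A) (h : RK_le a a) x : cell_map h x = x.
Proof. exact: val_inj. Qed.

Lemma cell_map_comp (a b e : A) (h : RK_le a b) (h' : RK_le b e)
  (h'' : RK_le a e) x : cell_map h' (cell_map h x) = cell_map h'' x.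
Proof. exact: val_inj. Qed.

Definition cells : diagram (@RK_le prime m n c c0) :=
  @Diagram _ _ (fun a => set_type (cell_set a)) cell_map cell_map_continuous
    cell_map_id cell_map_comp.

Definition cell_inj (a : A) : cells a -> S := set_val.

Lemma range_cell_inj (a : A) x : range (@cell_inj a) x <-> RK_le (cell_index x) a.
Proof.
split=> [[y _ <-]|h]; first exact: set_mem (valP y).
by exists (SigSub (mem_set (h : cell_set a x))).
Qed.

Lemma SC_little (x : S) : little_cubes (set_val x).
Proof. exact: SC_set_little (set_mem (valP x)). Qed.

Lemma cell_setP (a : A) (x : S) : cell_set a x <->
  forall i j, edge_arr (val a) i j -> fits prime (set_val x) (val a) i j.
Proof.
have [nd _ sepx] := (little_cubesP _).1 (SC_little x).
have [_ ea _ _] := set_mem (valP a).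
exact: config_graph_leP.
Qed.

Lemma closed_cell_set (a : A) : closed (cell_set a).
Proof.
rewrite (_ : cell_set a = \bigcap_(e in [set e : 'I_n * 'I_n |
    edge_arr (val a) e.1 e.2]) (set_val @^-1` [set C | fits prime C (val a) e.1 e.2])).
  apply: closed_bigI => e _; apply: preimage_closed; last exact: closed_fits.
  by move=> x _; exact: set_val_continuous.
apply/seteqP; split=> x; first by move/cell_setP => H e; exact: H.
by move=> H; apply/cell_setP => i j h; exact: (H (i, j)).
Qed.

Lemma cells_colimit : is_colimit (@cell_inj).
Proof.
apply: (@strata_colimit _ _ cells S (@cell_inj) cell_index _ (@RK_encode prime m n c c0)).
- exact: RK_le_refl.
- exact: RK_encode_inj.
- by split=> [a|a b h x] //; exact: set_val_continuous.
- by move=> a; exact: val_inj.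
- by move=> a B; apply: set_val_closed_map; exact: closed_cell_set.
- exact: range_cell_inj.
Qed.

(** * The boundary of a cell as a colimit *)

Section Boundary.
Variable a : A.

Definition boundary : set (cells a) := [set x | cell_index (set_val x) <> a].

Notation below_a := (@below _ (@RK_le prime m n c c0) a).

Lemma boundary_inj_proof (b : {b | below_a b}) (x : cells (sval b)) :
  cell_map (proj1 (svalP b)) x \in boundary.
Proof.
apply/mem_set => e; have [ba nba] := svalP b; apply: nba.
apply: (RK_le_anti ba).
have : RK_le (cell_index (set_val x)) (sval b) by exact: set_mem (valP x).
by move: e => /= ->.
Qed.

Definition boundary_inj (b : {b | below_a b}) (x : cells (sval b)) :
  set_type boundary := SigSub (boundary_inj_proof x).

Definition boundary_index (x : set_type boundary) : {b | below_a b} :=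
  exist _ (cell_index (set_val (set_val x)))
    (conj (set_mem (valP (set_val x))) (set_mem (valP x))).

Lemma boundary_colimit : is_colimit (F := Defs.restrict cells below_a) (@boundary_inj).
Proof.
have ci : continuous (fun x : set_type boundary => set_val (set_val x)).
  exact: continuous_fun_comp (@set_val_continuous _ _) (@set_val_continuous _ _).
apply: (@strata_colimit _ _ _ _ _ boundary_index _
  (fun b => @RK_encode prime m n c c0 (sval b))).
- by move=> b; exact: RK_le_refl.
- move=> [b hb] [b' hb'] /RK_encode_inj /= e; subst b'.
  by rewrite (Prop_irrelevance hb hb').
- split=> [b|b b' h x]; last by do 2 apply: val_inj.
  by do 2 apply: continuous_to_set_type; exact: set_val_continuous.
- move=> b x y e; apply: val_inj.
  exact: (congr1 (fun z : set_type boundary => set_val (set_val z)) e).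
- move=> b B cB.
  rewrite (_ : _ @` B = (fun x => set_val (set_val x)) @^-1` (set_val @` B)).
    apply: preimage_closed => [x _|]; first exact: ci.
    by apply: set_val_closed_map; first exact: closed_cell_set.
  apply/seteqP; split=> [_ [x Bx <-]|x [y By e]]; first by exists x.
  by exists y => //; do 2 apply: val_inj.
- move=> b x; split=> [[y _ <-]|h]; first exact: set_mem (valP y).
  exists (SigSub (mem_set (h : cell_set (sval b) (set_val (set_val x))))) => //.
  by do 2 apply: val_inj.
Qed.

End Boundary.

End Cells.

(** * The boundary inclusion is a cofibration *)

Section Moves.
Variables (R : realType) (m : nat) (q : upper_cube R m) (prime : bool).
Variables (n : nat) (c : 'I_n -> colour) (c0 : colour).
Hypothesis nonempty_profile : ~ nullary_open n c0.

Notation A := (RK_cell prime m c c0).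
Notation cells := (cells q prime c c0).

Definition underlying (a : A) (x : cells a) : config R m n := set_val (set_val x).

Lemma underlying_continuous (a : A) : continuous (@underlying a).
Proof.
exact: continuous_fun_comp (@set_val_continuous _ _) (@set_val_continuous _ _).
Qed.

Lemma underlying_inj (a : A) : injective (@underlying a).
Proof. by move=> x y e; do 2 apply: val_inj. Qed.

Definition in_cell (a : A) (C : config R m n) : Prop := SC_set q c c0 C /\
  forall i j, edge_arr (val a) i j -> fits prime C (val a) i j.

Lemma underlying_in_cell (a : A) (x : cells a) : in_cell a (underlying x).
Proof.
split; first exact: set_mem (valP (set_val x)).
by apply/cell_setP; exact: set_mem (valP x).
Qed.

Lemma mk_cell_proof (a : A) C (h : in_cell a C) :
  (SigSub (mem_set h.1) : SC_space q c c0) \in cell_set a.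
Proof. by apply/mem_set/cell_setP; exact: h.2. Qed.

Definition mk_cell (a : A) C (h : in_cell a C) : cells a := SigSub (mk_cell_proof h).

Lemma underlying_mk (a : A) C (h : in_cell a C) : underlying (mk_cell h) = C.
Proof. by []. Qed.

Lemma mk_cell_continuous (a : A) (Z : topologicalType) (F : Z -> config R m n)
    (hF : forall z, in_cell a (F z)) :
  continuous F -> continuous (fun z => mk_cell (hF z)).
Proof. by move=> cF; do 2 apply: continuous_to_set_type. Qed.

Lemma cells_nondegenerate (a : A) (x : cells a) : nondegenerate (underlying x).
Proof. by have [] := (little_cubesP _).1 (SC_little (set_val x)). Qed.

Lemma in_cell_intro (a : A) C : ~~ one_point n c0 ->
  (forall i (v : 'I_m), interval_ok c0 (c i) (v.+1 == m) (lo C i v) (hi C i v)) ->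
  (forall i j, edge_arr (val a) i j -> fits prime C (val a) i j) -> in_cell a C.
Proof.
move=> n1 ok H; have [ca ea _ _] := set_mem (valP a).
split=> //; apply/SC_setP => //; split=> //; exact: fits_separated H.
Qed.

Lemma in_cell_ok (a : A) C : ~~ one_point n c0 -> in_cell a C ->
  forall i (v : 'I_m), interval_ok c0 (c i) (v.+1 == m) (lo C i v) (hi C i v).
Proof. by move=> n1 [/SC_setP HC _]; have [] := HC nonempty_profile n1. Qed.

(** Every box shrinks towards its centre, down to half its size at time 1. All
separations are kept while gaps open between the boxes, so that boxes which were
almost separated in a smaller direction become separated. *)
Definition shrink (C : config R m n) (s : R) : config R m n :=
  make_config (fun i v => lo C i v + s / 4 * (hi C i v - lo C i v))
    (fun i v => hi C i v - s / 4 * (hi C i v - lo C i v)).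

Lemma shrink_in_cell (a : A) C s : ~~ one_point n c0 -> 0 <= s <= 1 ->
  in_cell a C -> in_cell a (shrink C s).
Proof.
move=> n1 s01 HC; have ok := in_cell_ok n1 HC.
apply: in_cell_intro => // [i v|i j aij].
  by rewrite lo_make hi_make; exact: interval_ok_shrink.
have narrower v k l : precedes prime C v k l -> precedes prime (shrink C s) v k l.
  have wk := interval_ok_lt (ok k v); have wl := interval_ok_lt (ok l v).
  have pk : 0 <= s / 4 * (hi C k v - lo C k v) by case/andP: s01 => s0 _; nra.
  have pl : 0 <= s / 4 * (hi C l v - lo C l v) by case/andP: s01 => s0 _; nra.
  by rewrite /precedes !hi_make !lo_make; case: (prime); lra.
by apply: fits_mono (HC.2 i j aij) => // v; exact: narrower.
Qed.

Variable a : A.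

Lemma flow_in_cell (p : cells a * unitI R) : in_cell a
  (if one_point n c0 then underlying p.1 else shrink (underlying p.1) (val p.2)).
Proof.
have h := underlying_in_cell p.1.
by case: ifPn => // n1; apply: shrink_in_cell => //; exact: unitI_range.
Qed.

Definition flow (p : cells a * unitI R) : cells a := mk_cell (flow_in_cell p).

Lemma flow_continuous : continuous flow.
Proof.
pose P : topologicalType := (cells a * unitI R)%type.
have c1 : continuous (fun p : P => underlying p.1).
  apply: (@continuous_fun_comp P _ _ fst) (@underlying_continuous a).
  by move=> p; exact: cvg_fst.
have c2 : continuous (fun p : P => val p.2 : R).
  apply: (@continuous_fun_comp P _ _ snd val) (@set_val_continuous _ _).
  by move=> p; exact: cvg_snd.
apply: mk_cell_continuous; case: (one_point n c0) => //.
have cl i v : continuous (fun p : P => lo (underlying p.1) i v).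
  exact: continuous_fun_comp c1 (@lo_continuous _ _ _ i v).
have ch i v : continuous (fun p : P => hi (underlying p.1) i v).
  exact: continuous_fun_comp c1 (@hi_continuous _ _ _ i v).
have cs i v : continuous (fun p : P =>
    val p.2 / 4 * (hi (underlying p.1) i v - lo (underlying p.1) i v) : R).
  apply: continuous_mul; last exact: continuous_sub.
  by apply: (continuous_mul c2) => p; exact: cvg_cst.
apply: make_config_continuous => i v; first exact: continuous_add.
exact: continuous_sub.
Qed.

Lemma flow0 x : flow (x, I0 R) = x.
Proof.
apply: underlying_inj; rewrite underlying_mk; case: ifP => // _.
apply: config_eq => i v; rewrite ?lo_make ?hi_make /=.
  by rewrite mul0r mul0r addr0.
by rewrite mul0r mul0r subr0.
Qed.

(** Inside the cell of [a] the graph of a configuration can only differ from [a]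
by having a smaller number on some edge. In this form the boundary is given by
finitely many inequalities, all of which shrinking the boxes makes easier to
satisfy. *)
Lemma boundaryP (x : cells a) : boundary x <-> exists i j (v : 'I_m),
  [/\ i != j, (v.+1 < edge_num (val a) i j)%N &
      hi (underlying x) i v <= lo (underlying x) j v].
Proof.
have [nd _ sepx] := (little_cubesP _).1 (SC_little (set_val x)).
rewrite -/(underlying x) in nd sepx.
have [_ ea _ _] := set_mem (valP a).
have G := config_graph_edges prime nd sepx.
have xa : graph_le (config_graph prime (underlying x)) (val a).
  exact: set_mem (valP x).
split=> [bx|[i [j [v [ij lt sv]]]] e]; last first.
  have : apart prime (underlying x) v.+1 i j.
    rewrite /apart; apply/orP; case E : prime; [left|right];
      by apply/beforeP; exists v => //; rewrite /precedes E.
  move=> /least_direction_min; rewrite -config_graph_num // leqNgt => /negP; apply.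
  have e' : config_graph prime (underlying x) = val a := congr1 val e.
  by rewrite e'.
apply: contrapT => no; apply: bx; apply: val_inj; apply/ffunP => -[i j].
have [<-|ij] := eqVneq i j.
  by have [-> _] := ea; have [-> _] := G.
case: (xa i j ij) => // lt; exfalso; apply: no.
have [_ numC _] := ea.2 i j ij.
have := apart_least prime sepx ij; rewrite -config_graph_num // => ap.
have key k l : before prime (underlying x)
    (edge_num (config_graph prime (underlying x)) i j) k l ->
    exists2 v : 'I_m, (v.+1 < edge_num (val a) i j)%N &
      (hi (underlying x) k v <= lo (underlying x) l v) ||
      (hi (underlying x) l v <= lo (underlying x) k v).
  case/beforeP=> v ev h; exists v; first by rewrite ev.
  by move: h; rewrite /precedes; case: (prime) => ->; rewrite ?orbT.
have [v lv sv] : exists2 v : 'I_m, (v.+1 < edge_num (val a) i j)%N &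
      (hi (underlying x) i v <= lo (underlying x) j v) ||
      (hi (underlying x) j v <= lo (underlying x) i v).
  by case/orP: ap => /key// [v lv sv]; exists v; rewrite // orbC.
case/orP: sv => sv; first by exists i, j, v.
by exists j, i, v; rewrite eq_sym numC.
Qed.

Definition push_time (C : config R m n) i j v : R :=
  Num.max 0 (hi C i v - lo C j v) * 4 /
    ((hi C i v - lo C i v) + (hi C j v - lo C j v)).

(** The default value 2 exceeds the duration of the flow, which is right for the
cells with empty boundary. *)
Definition boundary_time (x : cells a) : R :=
  \big[Num.min/2]_(e : 'I_n * 'I_n * 'I_m |
      (e.1.1 != e.1.2) && (e.2.+1 < edge_num (val a) e.1.1 e.1.2)%N)
    push_time (underlying x) e.1.1 e.1.2 e.2.

Lemma width_gt0 (C : config R m n) i j v : nondegenerate C ->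
  0 < (hi C i v - lo C i v) + (hi C j v - lo C j v).
Proof. by move=> nd; have := nd i v; have := nd j v; lra. Qed.

Lemma push_time_ge0 (C : config R m n) i j v : nondegenerate C -> 0 <= push_time C i j v.
Proof.
move=> nd; rewrite divr_ge0 ?(ltW (width_gt0 _ _ _ nd)) // mulr_ge0 //.
by rewrite le_max lexx.
Qed.

Lemma push_time_eq0 (C : config R m n) i j v : nondegenerate C ->
  (push_time C i j v == 0) = (hi C i v <= lo C j v).
Proof.
move=> nd; rewrite !mulf_eq0 invr_eq0 (gt_eqF (width_gt0 _ _ _ nd)) orbF.
by rewrite pnatr_eq0 orbF eq_maxl subr_le0.
Qed.

(** The overlap [hi C i v - lo C j v] decreases at the rate of a quarter of the
sum of the widths of the two boxes. *)
Lemma shrink_push_time (C : config R m n) i j v : nondegenerate C ->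
  hi (shrink C (push_time C i j v)) i v <= lo (shrink C (push_time C i j v)) j v.
Proof.
move=> nd; have w0 := width_gt0 i j v nd; rewrite hi_make lo_make.
have e : push_time C i j v / 4 * ((hi C i v - lo C i v) + (hi C j v - lo C j v))
    = Num.max 0 (hi C i v - lo C j v).
  rewrite /push_time; field; exact: lt0r_neq0.
have : hi C i v - lo C j v <= Num.max 0 (hi C i v - lo C j v).
  by rewrite le_max lexx orbT.
by rewrite -e mulrDr; lra.
Qed.

Lemma boundary_time_continuous : continuous boundary_time.
Proof.
apply: bigmin_continuous => -[[i j] v] /=.
have cl k : continuous (fun x => lo (@underlying a x) k v).
  exact: continuous_fun_comp (@underlying_continuous a) (@lo_continuous _ _ _ k v).
have ch k : continuous (fun x => hi (@underlying a x) k v).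
  exact: continuous_fun_comp (@underlying_continuous a) (@hi_continuous _ _ _ k v).
have cgap : continuous (fun x : cells a =>
    Num.max 0 (hi (underlying x) i v - lo (underlying x) j v) : R).
  have cs := continuous_sub (ch i) (cl j).
  have cst0 : continuous (fun _ : cells a => 0 : R^o) by exact: cst_continuous.
  by move=> x; exact: continuous_max (cst0 x) (cs x).
have cw : continuous (fun x : cells a =>
    ((hi (underlying x) i v - lo (underlying x) i v) +
     (hi (underlying x) j v - lo (underlying x) j v))^-1 : R).
  have cw' := continuous_add (continuous_sub (ch i) (cl i))
    (continuous_sub (ch j) (cl j)).
  move=> x; apply: (cvgV _ (cw' x)).
  exact: lt0r_neq0 (width_gt0 i j v (@cells_nondegenerate a x)).
have c4 : continuous (fun _ : cells a => 4 : R) by exact: cst_continuous.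
exact: continuous_mul (continuous_mul cgap c4) cw.
Qed.

Lemma boundary_time_ge0 x : 0 <= boundary_time x.
Proof.
apply: le_bigmin => // e _; exact: push_time_ge0 (cells_nondegenerate x).
Qed.

Lemma boundary_time_eq0 x : boundary x <-> boundary_time x = 0.
Proof.
have nd := cells_nondegenerate x.
split=> [/boundaryP[i [j [v [ij lt sv]]]]|].
  apply/eqP; rewrite eq_le boundary_time_ge0 andbT.
  have /eqP <- : push_time (underlying x) i j v == 0 by rewrite push_time_eq0.
  by apply: (@bigmin_le_cond _ _ _ _ (i, j, v)); rewrite /= ij.
move=> h; apply/boundaryP; rewrite /boundary_time in h.
have [h2|[[[i j] v] /= /andP[ij lt] e]] := bigmin_attained
  (fun e : 'I_n * 'I_n * 'I_m => (e.1.1 != e.1.2) && (e.2.+1 < edge_num (val a) e.1.1 e.1.2)%N)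
  2 (fun e => push_time (underlying x) e.1.1 e.1.2 e.2).
  by move/eqP: h2; rewrite h eq_sym pnatr_eq0.
by exists i, j, v; split=> //; rewrite -push_time_eq0 // -e h.
Qed.

Lemma flow_boundary_time x : boundary_time x <= 1 ->
  boundary (flow (x, clampI (boundary_time x))).
Proof.
move=> h; have nd := cells_nondegenerate x.
have t01 : 0 <= boundary_time x <= 1 by rewrite boundary_time_ge0 h.
have [h2|[[[i j] v] /= /andP[ij lt] e]] := bigmin_attained
  (fun e : 'I_n * 'I_n * 'I_m => (e.1.1 != e.1.2) && (e.2.+1 < edge_num (val a) e.1.1 e.1.2)%N)
  2 (fun e => push_time (underlying x) e.1.1 e.1.2 e.2).
  by move: h; rewrite /boundary_time h2; lra.
apply/boundaryP; exists i, j, v; split => //; rewrite underlying_mk ifN.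
  have -> : val (x, clampI (boundary_time x)).2 = boundary_time x := clampI_id t01.
  by rewrite /= /boundary_time e; exact: shrink_push_time.
apply/negP; rewrite /one_point; case: (c0) => // /eqP n1.
by rewrite (ord_uniq1 i j n1) eqxx in ij.
Qed.

Lemma boundary_closed_cofibration :
  closed_cofibration R (set_val : set_type (@boundary _ _ _ _ _ _ _ a) -> cells a).
Proof.
apply: (@push_closed_cofibration R _ _ boundary_time flow).
- exact: boundary_time_continuous.
- exact: boundary_time_ge0.
- exact: boundary_time_eq0.
- exact: flow_continuous.
- exact: flow0.
- exact: flow_boundary_time.
Qed.

Lemma cells_latching : latching_closed_cofibration R cells a.
Proof.
exists (set_type (@boundary _ _ _ _ _ _ _ a)), (@boundary_inj _ _ _ _ _ _ _ a), set_val.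
split; [exact: boundary_colimit| |exact: boundary_closed_cofibration].
by move=> b h x; apply: val_inj.
Qed.

End Moves.

(** * Contraction of a cell *)

Section Contraction.
Variables (R : realType) (m : nat) (hm : (0 < m)%N) (q : upper_cube R m).
Variables (prime : bool) (n : nat) (c : 'I_n -> colour) (c0 : colour).
Hypothesis nonempty_profile : ~ nullary_open n c0.
Variable a : RK_cell prime m c c0.

Notation cells := (cells q prime c c0).

(** The progress at time [t] of the motion along the axis [v], which takes place
during the time interval from [(m - v - 1) / m] to [(m - v) / m], the axes being
counted from 0. *)
Definition stage (t : R) (v : 'I_m) : R :=
  val (clampI (m%:R * t - (m%:R - v.+1%:R))).

Lemma stage_range t v : 0 <= stage t v <= 1.
Proof. exact: set_mem (valP (clampI _)). Qed.

Lemma stage0 v : stage 0 v = 0.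
Proof.
rewrite /stage /= mulr0 sub0r opprB; apply/max_idPl.
by rewrite ge_min subr_le0 ler_nat ltn_ord orbT.
Qed.

Lemma stage1 v : stage 1 v = 1.
Proof.
rewrite /stage /= mulr1 opprB addrC subrK min_l; last by rewrite ler1n.
by apply/max_idPr.
Qed.

(** The direction [v] only starts to move once the larger directions have
arrived. *)
Lemma stage_lt t (v w : 'I_m) : (v < w)%N -> 0 < stage t v -> stage t w = 1.
Proof.
move=> vw; rewrite /stage /= lt_max ltxx /= lt_min => /andP[_ h].
rewrite min_l; first by apply/max_idPr.
have : v.+2%:R <= w.+1%:R :> R by rewrite ler_nat.
by rewrite -[v.+2]addn1 natrD; lra.
Qed.

Lemma stage_continuous v : continuous (fun t => stage t v).
Proof.
apply: (@continuous_fun_comp _ _ _ (fun t : R => clampI (m%:R * t - (m%:R - v.+1%:R)))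
  (val : unitI R -> R)); last exact: set_val_continuous.
apply: continuous_fun_comp (@clampI_continuous R).
have cc (r : R) : continuous (fun _ : R => r) by exact: cst_continuous.
apply: continuous_sub (cc _); apply: continuous_mul (cc _) _.
by move=> t; exact: cvg_id.
Qed.

Notation tlo := (target_lo R prime c c0 (val a)).
Notation thi := (target_hi R prime (val a)).

Definition contract (C : config R m n) (t : R) : config R m n :=
  make_config (fun i v => lo C i v + stage t v * (tlo i v - lo C i v))
    (fun i v => hi C i v + stage t v * (thi i v - hi C i v)).

Lemma contract_in_cell C t : ~~ one_point n c0 -> in_cell q a C ->
  in_cell q a (contract C t).
Proof.
move=> n1 HC; have ok := in_cell_ok nonempty_profile n1 HC.
have Ha := set_mem (valP a).
apply: in_cell_intro => // [i v|i j aij].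
  rewrite lo_make hi_make; apply: interval_ok_convex; first exact: stage_range.
    exact: ok.
  exact: target_ok.
pose Z : config R m n := target R m prime c c0 (val a).
have lo_c k v : lo (contract C t) k v = lo C k v + stage t v * (lo Z k v - lo C k v).
  by rewrite !lo_make.
have hi_c k v : hi (contract C t) k v = hi C k v + stage t v * (hi Z k v - hi C k v).
  by rewrite !hi_make.
have moved v k l : stage t v = 1 -> precedes prime Z v k l ->
    precedes prime (contract C t) v k l.
  move=> e; rewrite (@precedes_eq _ _ _ _ Z) // => k'.
    by rewrite lo_c e mul1r addrC subrK.
  by rewrite hi_c e mul1r addrC subrK.
have unmoved v k l : stage t v = 0 -> precedes prime C v k l ->
    precedes prime (contract C t) v k l.
  move=> e; rewrite (@precedes_eq _ _ _ _ C) // => k'.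
    by rewrite lo_c e mul0r addr0.
  by rewrite hi_c e mul0r addr0.
have /beforeP[w ew wij] := target_fits R hm Ha aij.
have [e1|w1] := eqVneq (stage t w) 1.
  apply/orP; left; apply/beforeP; exists w => //; exact: moved e1 wij.
have lower (v : 'I_m) : (v < w)%N -> stage t v = 0.
  move=> vw; apply: contraNeq w1 => v0; apply/eqP; apply: (stage_lt vw).
  by rewrite lt_def v0; case/andP: (stage_range t v).
case/orP: (HC.2 i j aij) => [/beforeP[w' ew' h]|/existsP[k h]]; apply/orP.
  have ww : w' = w by apply/val_inj/succn_inj; rewrite ew ew'.
  left; apply/beforeP; exists w => //; rewrite ww in h.
  exact: precedes_convex (stage_range t w) (lo_c ^~ w) (hi_c ^~ w) h wij.
right; apply/existsP; exists k; case/orP: h => /beforeP[v ev h]; apply/orP;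
  [left|right]; apply/beforeP; exists v => //; apply: unmoved h; apply: lower;
  by have := ltn_ord k; rewrite -ev -ew.
Qed.

Lemma target_in_cell : ~~ one_point n c0 ->
  in_cell q a (target R m prime c c0 (val a)).
Proof.
move=> n1; apply: in_cell_intro => // [i v|i j aij].
  by rewrite lo_make hi_make; exact: target_ok.
by rewrite /fits target_fits //; exact: set_mem (valP a).
Qed.

Lemma one_point_contractible : one_point n c0 -> contractible R (cells a).
Proof.
move=> n1; have [e0 en] : c0 = op /\ n = 1%N.
  by move: n1; rewrite /one_point; case: (c0) => // /eqP.
have SCE : SC_set q c c0 = [set standard_config q c].
  have h0 : (n == 0%N) = false by rewrite en.
  have h1 : (n == 1%N) = true by rewrite en.
  by rewrite e0 /SC_set h0 h1.
have h : in_cell q a (standard_config q c).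
  split; first by rewrite SCE.
  have [_ ea _ _] := set_mem (valP a).
  by move=> i j /(edge_irr ea); rewrite (ord_uniq1 i j en) eqxx.
exists (mk_cell h), fst; split=> [x|x]; first exact: cvg_fst.
split=> //; apply: underlying_inj; rewrite underlying_mk.
by have [+ _] := underlying_in_cell x; rewrite SCE.
Qed.

(** One direction after the other, from the last one to the first, the boxes
move linearly to the target. While the coordinates of direction [v] move, the
edges of larger number are satisfied since they have reached the target, those
of number [v] because the condition on them is convex, unless they are, like
those of smaller number, explained by a smaller direction, whose coordinates
have not moved yet. *)
Lemma cells_contractible : contractible R (cells a).
Proof.
have [n1|n1] := boolP (one_point n c0); first exact: one_point_contractible.
pose P : topologicalType := (cells a * unitI R)%type.
have Hp (p : P) : in_cell q a (contract (underlying p.1) (val p.2)).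
  exact: contract_in_cell (underlying_in_cell p.1).
exists (mk_cell (target_in_cell n1)), (fun p : P => mk_cell (Hp p)); split.
  have c1 : continuous (fun p : P => underlying p.1).
    apply: (@continuous_fun_comp P _ _ fst) (@underlying_continuous _ _ _ _ _ _ _ a).
    by move=> p; exact: cvg_fst.
  have c2 v : continuous (fun p : P => stage (val p.2) v).
    apply: (@continuous_fun_comp P _ _ (fun p => val p.2) (fun t => stage t v)).
      apply: (@continuous_fun_comp P _ _ snd val) (@set_val_continuous _ _).
      by move=> p; exact: cvg_snd.
    exact: stage_continuous.
  have cc (r : R) : continuous (fun _ : P => r) by exact: cst_continuous.
  apply: mk_cell_continuous; apply: make_config_continuous => i v.
    have cl := continuous_fun_comp c1 (@lo_continuous _ _ _ i v).
    exact: continuous_add cl (continuous_mul (c2 v) (continuous_sub (cc _) cl)).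
  have ch := continuous_fun_comp c1 (@hi_continuous _ _ _ i v).
  exact: continuous_add ch (continuous_mul (c2 v) (continuous_sub (cc _) ch)).
move=> x; split; apply: underlying_inj; rewrite underlying_mk.
  by apply: config_eq => i v; rewrite ?lo_make ?hi_make /= stage0 mul0r addr0.
by apply: config_eq => i v; rewrite ?lo_make ?hi_make /= stage1 mul1r addrC subrK.
Qed.


End Contraction.

(** * Compatibility with the operad structures *)

Section Operads.
Variables (R : realType) (m : nat) (q : upper_cube R m) (prime : bool).

Lemma config_graph_act n (s : 'S_n) (C : config R m n) :
  config_graph prime (config_act s C) = graph_act s (config_graph prime C).
Proof.
have E i : cube_at (config_act s C) i = cube_at C ((s^-1)%g i).
  by rewrite {1}/cube_at mxE.
have b k i j : before prime (config_act s C) k i j =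
    before prime C k ((s^-1)%g i) ((s^-1)%g j).
  by apply: eq_existsb => v; rewrite /precedes /lo /hi !E.
have d i j : least_direction prime (config_act s C) i j =
    least_direction prime C ((s^-1)%g i) ((s^-1)%g j).
  by congr _.+1; apply: eq_find => k; rewrite /apart !b.
apply/ffunP => -[i j].
by rewrite !ffunE /= (inj_eq (@perm_inj _ (s^-1)%g)) d b.
Qed.

Lemma graph_act_le n (s : 'S_n) (a b : graph n) :
  graph_le (graph_act s a) (graph_act s b) <-> graph_le a b.
Proof.
split=> H i j ij.
  have := H (s i) (s j); rewrite (inj_eq (@perm_inj _ s)) => /(_ ij).
  by rewrite !graph_act_num !ffunE /= !permK.
rewrite !graph_act_num !ffunE /=; apply: H.
by rewrite (inj_eq (@perm_inj _ (s^-1)%g)).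
Qed.

Section Action.
Variables (n : nat) (c : 'I_n -> colour) (c0 : colour) (s : 'S_n).

Lemma cell_index_act (a : RK_cell prime m c c0) (x : SC_space q c c0) :
  RK_le (cell_index prime (SC_act s x)) (RK_act s a) <->
  RK_le (cell_index prime x) a.
Proof.
by rewrite /RK_le /= [set_val _]/= config_graph_act graph_act_le.
Qed.

Lemma SC_act_surj (y : SC_space q (perm_colours s c) c0) :
  exists x : SC_space q c c0, SC_act s x = y.
Proof.
have e : perm_colours (s^-1)%g (perm_colours s c) = c.
  by apply/funext => i; rewrite /perm_colours invgK permK.
have := SC_act_proof (s^-1)%g y; rewrite e => h.
exists (SigSub h); apply: val_inj; apply/rowP => i.
by rewrite /= /config_act mxE /cube_at mxE invgK permKV.
Qed.

Lemma range_cell_act (a : RK_cell prime m c c0) :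
  range (@cell_inj _ _ q prime _ _ c0 (RK_act s a)) =
  SC_act s @` range (@cell_inj _ _ q prime _ c c0 a).
Proof.
apply/seteqP; split=> [y /range_cell_inj ya|_ [x /range_cell_inj xa <-]].
  have [x e] := SC_act_surj y; rewrite -e in ya *.
  by exists x => //; apply/range_cell_inj; exact: (cell_index_act a x).1.
by apply/range_cell_inj; exact: (cell_index_act a x).2.
Qed.

End Action.

Section Composition.
Variables (n : nat) (c : 'I_n -> colour) (c0 : colour) (k : 'I_n -> nat).
Variable d : forall i, 'I_(k i) -> colour.
Arguments d : clear implicits.

Section Substitution.
Variables (C : config R m n) (D : forall i, config R m (k i)).
Arguments D : clear implicits.
Hypotheses (ndC : nondegenerate C) (LD : forall i, little_cubes (D i)).

Lemma precedes_subst_inside i (u u' : 'I_(k i)) v : precedes prime (D i) v u u' ->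
  precedes prime (subst_config C D) v (tagnat.Rank _ u) (tagnat.Rank _ u').
Proof.
have w0 := ndC i v; rewrite /precedes /lo /hi !cube_at_subst !mxE.
by case: (prime) => h; rewrite lerD2l ler_pM2l ?subr_gt0 // ler_pM2r ?invr_gt0 // lerD2r.
Qed.

Lemma precedes_subst_across i j (u : 'I_(k i)) (u' : 'I_(k j)) v :
  precedes prime C v i j ->
  precedes prime (subst_config C D) v (tagnat.Rank _ u) (tagnat.Rank _ u').
Proof.
have [h1 _ h2] := subst_bounds (ndC i v) ((LD i).1 u v).
have [h3 _ h4] := subst_bounds (ndC j v) ((LD j).1 u' v).
rewrite /precedes /lo /hi !cube_at_subst; case: (prime) => h.
  exact: le_trans h2 (le_trans h h3).
exact: le_trans h4 (le_trans h h1).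
Qed.

End Substitution.

(** A substitution keeps the separations of the outer configuration between
boxes of different blocks, and those of the inner ones within a block. *)
Lemma cell_comp (a : RK_cell prime m c c0) (aa : forall i, RK_cell prime m (d i) (c i))
    (h : ~ nullary_open (\sum_i k i) c0) (x : SC_space q c c0)
    (y : forall i, SC_space q (d i) (c i)) :
  cell_set a x -> (forall i, cell_set (aa i) (y i)) ->
  cell_set (RK_comp a aa) (SC_comp h x y).
Proof.
move=> /cell_setP xa ya; apply/cell_setP => l l' all'.
have [_ ec _ _] := set_mem (valP (RK_comp a aa)).
have ll' := edge_irr ec all'.
(* In a one-point component there are no two boxes to be compared. *)
have [e|one] := pselect (c0 = op /\ (\sum_i k i)%N = 1%N).
  by move: ll'; rewrite (ord_uniq1 l l' e.2) eqxx.
have -> : set_val (SC_comp h x y) = subst_config (set_val x) (fun i => set_val (y i)).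
  by rewrite -(comp_config_subst q d _ _ one).
have [nd _ _] := (little_cubesP _).1 (SC_little x).
have LD i : little_cubes (set_val (y i)) by exact: SC_little.
move: all' ll'; rewrite /=.
case: (RankP l) => i [u ->]; case: (RankP l') => j [u' ->].
have [e|ij] := eqVneq i j.
  subst j; rewrite /edge_arr graph_comp_Rank => all' _.
  have := (cell_setP _ _).1 (ya i) u u' all'.
  apply: fits_mono; first by rewrite /edge_num graph_comp_Rank.
    by move=> v; exact: precedes_subst_inside.
  by move=> v; exact: precedes_subst_inside.
rewrite /edge_arr graph_comp_RankN // => all' _.
apply: fits_mono (xa i j all'); first by rewrite /edge_num graph_comp_RankN.
  by move=> v; exact: precedes_subst_across.
by move=> v; exact: precedes_subst_across.
Qed.

End Composition.

Lemma SC_cellular : (0 < m)%N -> cellular R (RK_operad_gen prime m) (SC q).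
Proof.
move=> hm; exists (fun n c c0 => cells q prime c c0),
  (fun n c c0 => @cell_inj _ _ q prime n c c0).
split=> [n c c0 ne|n c c0 s a|n c c0 k d a aa h x y].
- split=> [|a]; first exact: cells_colimit.
  by split; [exact: cells_latching|exact: cells_contractible].
- exact: range_cell_act.
- move=> /range_cell_inj xa ya; apply/range_cell_inj.
  apply: cell_comp => [|i]; first exact: xa.
  exact: (range_cell_inj _ _).1 (ya i).
Qed.

End Operads.

Theorem theorem3p5 (R : realType) (m : nat) (hm : (1 <= m)%N)
    (q : upper_cube R m) :
  cellular R (RK m) (SC q) /\ cellular R (RK' m) (SC q).
Proof. by split; exact: SC_cellular. Qed.
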